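(* (1) For $\ell=1$: if $\lambda,\mu,\nu$ are regular irreducible representations of $\mathrm G(\mathfrak o_1)$ all of type $\mathbf{sns}$, then the multiplicity of $\nu$ in $\lambda\otimes\mu$ is at most $1$. (2) For $\ell\geq 2$: there exist regular irreducible representations $\lambda,\mu,\nu$ of $\mathrm G(\mathfrak o_\ell)$, all of type $\mathbf{sns}$, such that the multiplicity of $\nu$ in $\lambda\otimes\mu$ is at least $(q-2)q^{\lfloor \ell/2\rfloor-1}$.
   Context: Let $\mathcal O$ be a complete discrete valuation ring with maximal ideal $\mathfrak p=\pi\mathcal O$ and finite residue field of odd characteristic and cardinality $q$. Let $\mathfrak O=\mathcal O[\vartheta]$ be the unramified quadratic extension, with $\vartheta^2\in\mathcal O^\times$ a non-square, and Galois involution $x\mapsto x^\circ$, $\vartheta^\circ=-\vartheta$. For $\ell\geq1$ let $\mathfrak o_\ell=\mathcal O/\mathfrak p^\ell$ and $\mathfrak O_\ell=\mathfrak O/\pi^\ell\mathfrak O$. $\mathrm G$ denotes either $\mathrm{GL}_2$ (so $\mathrm G(\mathfrak o_\ell)=\mathrm{GL}_2(\mathfrak o_\ell)$, $R_\ell=\mathfrak o_\ell$, $\mathfrak g(\mathfrak o_\ell)=M_2(\mathfrak o_\ell)$) or $\mathrm{GU}_2$ (so $\mathrm G(\mathfrak o_\ell)=\{A\in \mathrm{GL}_2(\mathfrak O_\ell): A^\star A=I\}$ where $(a_{ij})^\star=W(a_{ji}^\circ)W^{-1}$, $W=\begin{pmatrix}0&1\\1&0\end{pmatrix}$, $R_\ell=\mathfrak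 O_\ell$, $\mathfrak g(\mathfrak o_\ell)=\{A\in M_2(\mathfrak O_\ell):A+A^\star=0\}$). Fix an additive character $\psi$ of $R_\ell$ nontrivial on $\pi^{\ell-1}\mathfrak o_\ell$. For $\ell\ge2$ let $K^{\ell-1}=\{I+\pi^{\ell-1}B\}\cap\mathrm G(\mathfrak o_\ell)$ and for $A\in\mathfrak g(\mathfrak o_1)$ let $\psi_A(I+\pi^{\ell-1}B)=\psi(\pi^{\ell-1}\mathrm{tr}(\tilde AB))$ with $\tilde A$ a lift of $A$. For $\ell\geq 2$, an irreducible representation $\rho$ of $\mathrm G(\mathfrak o_\ell)$ is regular if every $\psi_A$ occurring in $\rho|_{K^{\ell-1}}$ has $A$ non-scalar; its type is $\mathbf{cus}$, $\mathbf{ss}$, $\mathbf{sns}$ according as $\dim\rho=(q-1)q^{\ell-1}$, $(q+1)q^{\ell-1}$, $(q^2-1)q^{\ell-2}$. For $\ell=1$, the regular representations are the non-linear irreducible representations of $\mathrm G(\mathfrak o_1)$, of type $\mathbf{cus}$, $\mathbf{ss}$, $\mathbf{sns}$ according as the dimension is $q-1$, $q+1$, $q$. *)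

(* Defs.v *)
From HB Require Import structures.
From mathcomp Require Import all_boot all_order all_algebra all_fingroup all_solvable.
From mathcomp Require Import all_field all_character.
Set Implicit Arguments. Unset Strict Implicit. Unset Printing Implicit Defensive.
Import Order.TTheory GRing.Theory Num.Theory.

Local Open Scope ring_scope.

(* ---------- The base ring o_l = O / p^l, encoded as a finite chain ring ---------- *)
Definition chain_ring (R : finComUnitRingType) (pi : R) (l : nat) : Prop :=
  [/\ (0 < l)%N,
      (forall x : R, x \isn't a GRing.unit -> exists y, x = pi * y),
      pi ^+ l = 0 & pi ^+ l.-1 != 0].

Definition resq (R : finComUnitRingType) (pi : R) : nat :=
  #|R| %/ #|[set (pi * x)%R | x : R]|.

Definition unram_quad_ext (R S : finComUnitRingType) (iota : {rmorphism R -> S})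
    (sigma : {rmorphism S -> S}) (theta : S) (eps : R) : Prop :=
  [/\ eps \is a GRing.unit /\ (forall x : R, x ^+ 2 != eps),
      theta ^+ 2 = iota eps,
      sigma theta = - theta /\ (forall a, sigma (iota a) = iota a),
      (forall s : S, exists a b, s = iota a + iota b * theta) &
      (forall a b c d, iota a + iota b * theta = iota c + iota d * theta ->
                       a = c /\ b = d)].

Definition Wmx (S : finComUnitRingType) : 'M[S]_2 :=
  \matrix_(i, j) (i != j)%:R.

Definition mxstar (S : finComUnitRingType) (sigma : {rmorphism S -> S})
  (A : 'M[S]_2) : 'M[S]_2 := Wmx S *m (map_mx sigma A)^T *m Wmx S.

Lemma Wmx_sqr (S : finComUnitRingType) : Wmx S *m Wmx S = 1%:M.
Proof.
apply/matrixP => i j; rewrite !mxE big_ord_recr big_ord1 /= !mxE.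
by case: i => [[|[|//]] ?]; case: j => [[|[|//]] ?] /=; rewrite ?mulr0 ?mul0r ?mulr1 ?addr0 ?add0r.
Qed.

Lemma mxstar1 (S : finComUnitRingType) (sigma : {rmorphism S -> S}) : @mxstar S sigma 1%:M = 1%:M.
Proof. by rewrite /mxstar map_mx1 trmx1 mulmx1 Wmx_sqr. Qed.

Lemma mxstarM (S : finComUnitRingType) (sigma : {rmorphism S -> S}) (A B : 'M[S]_2) :
  mxstar sigma (A *m B) = mxstar sigma B *m mxstar sigma A.
Proof.
rewrite /mxstar map_mxM trmx_mul.
set b := (map_mx sigma B)^T; set a := (map_mx sigma A)^T; set W := Wmx S.
have h : W *m W = 1%:M by exact: Wmx_sqr.
by rewrite !mulmxA -(mulmxA _ W W) h mulmx1.
Qed.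

Definition GU_set (S : finComUnitRingType) (sigma : {rmorphism S -> S})
  : {set {'GL_2[S]}} :=
  [set g : {'GL_2[S]} | mxstar sigma (GLval g) *m GLval g == 1%:M].

Lemma GU_group_set (S : finComUnitRingType) (sigma : {rmorphism S -> S}) : group_set (@GU_set S sigma).
Proof.
apply/group_setP; split; first by rewrite inE GL_1E mxstar1 mul1mx.
move=> x y; rewrite !inE => /eqP hx /eqP hy.
by rewrite GL_MxE mxstarM mulmxA -(mulmxA _ _ (GLval x)) hx mulmx1 hy.
Qed.

Canonical GU_group (S : finComUnitRingType) (sigma : {rmorphism S -> S}) := Group (@GU_group_set S sigma).

Definition lieU (S : finComUnitRingType) (sigma : {rmorphism S -> S})
  (A : 'M[S]_2) : bool := A + mxstar sigma A == 0.

Definition additive_character (Rl : finComUnitRingType) (psi : Rl -> algC) : Prop :=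
  psi 0 = 1 /\ forall a b, psi (a + b) = psi a * psi b.

Section Generic.
Variables (Rl : finComUnitRingType) (G : {group {'GL_2[Rl]}})
  (lie : pred 'M[Rl]_2) (pi : Rl) (psi : Rl -> algC) (q l : nat).

Definition Kcong : {set {'GL_2[Rl]}} :=
  [set g in G | [exists B : 'M[Rl]_2, GLval g == 1%:M + pi ^+ l.-1 *: B]].

(* psi_A (I + pi^(l-1) B) = psi(pi^(l-1) tr(A B)) = psi(tr(A (g - 1))) ;
   psi_A occurs in rho|_K iff the (unnormalised) inner product is nonzero *)
Definition psiA_occurs (chi : 'CF(G)) (A : 'M[Rl]_2) : bool :=
  \sum_(g in Kcong) chi g * (psi (\tr (A *m (GLval g - 1%:M))))^* != 0.

Definition scalar_mod_pi (A : 'M[Rl]_2) : bool :=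
  [exists c : Rl, [exists B : 'M[Rl]_2, A == c%:M + pi *: B]].

(* regular, for l >= 2: every psi_A occurring in rho|_K has A non-scalar;
   A ranges over lifts in g(o_l) of elements of g(o_1) *)
Definition regular_ge2 (i : Iirr G) : Prop :=
  forall A : 'M[Rl]_2, lie A -> psiA_occurs 'chi_i A -> ~~ scalar_mod_pi A.

Definition reg_sns (i : Iirr G) : Prop :=
  if l == 1%N then 'chi_i 1%g != 1 /\ 'chi_i 1%g = q%:R
  else regular_ge2 i /\ 'chi_i 1%g = ((q ^ 2 - 1) * q ^ (l - 2))%:R.

Definition thm_props : Prop :=
  (l = 1%N -> forall i j k : Iirr G, reg_sns i -> reg_sns j -> reg_sns k ->
     '['chi_i * 'chi_j, 'chi_k] <= 1) /\
  ((2 <= l)%N -> exists i j k : Iirr G, [/\ reg_sns i, reg_sns j, reg_sns k &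
     ((q - 2) * q ^ (l./2 - 1))%:R <= '['chi_i * 'chi_j, 'chi_k]]).
End Generic.

(* Main.v *)
(**
  GL_2 and GU_2 are treated together: all that is used of a group G inside
  GL_2(S) is recorded in [rank_one].

  Level 1. Let chi be irreducible of degree q and P a Borel subgroup. Counting
  multiplicities over the unipotent radical shows that chi restricted to P is
  tau + eta, with tau linear and eta irreducible, and then Ind_P tau =
  chi + alpha with alpha a linear character of G extending tau. Writing nu as
  Ind_P (Res_P alpha) - alpha, the multiplicity of nu in lambda (x) mu is
  <Res_P lambda, Res_P nu'> - <lambda, nu'>, where nu' is alpha times the
  conjugate of mu. The first term is at most 2, and equals 2 only if the linear
  parts of lambda and nu' on P agree, which forces lambda = nu'.

  Level l >= 2. Put m = floor(l/2) and k = l - m, and let H be the subgroup of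
  matrices (a b; c d) with c = 0 mod pi^k and a = d mod pi^m. The maps
  chi_t (a b; c d) = psi (t w c / a), with w = 1 for GL_2 and w = theta for
  GU_2, are linear characters of H; for units t they are conjugate under the
  torus and induce the same irreducible character Lambda, of type sns. As
  chi_1 chi_t = chi_{1+t}, the multiplicity of Lambda in Lambda (x) Lambda, which
  is <chi_1 Res_H Lambda, Res_H Lambda>, is at least the number of classes t
  mod pi^m such that t and 1 + t are units, that is (q - 2) q^(m - 1).
*)
Require Import Defs.
From HB Require Import structures.
From mathcomp Require Import all_boot all_order all_algebra all_fingroup all_solvable.
From mathcomp Require Import all_field all_character.
From mathcomp Require Import zify ring.
Set Implicit Arguments. Unset Strict Implicit. Unset Printing Implicit Defensive.
Import Order.TTheory GRing.Theory Num.Theory.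
Local Open Scope ring_scope.

(** * Counting along the fibres of a map *)

Lemma card_fibers (aT rT : finType) (A : {set aT}) (B : {set rT})
    (f : aT -> rT) n :
  {in A, forall x, f x \in B} ->
  {in B, forall y, #|[set x in A | f x == y]| = n} -> #|A| = (#|B| * n)%N.
Proof.
move=> fAB fib; rewrite -sum1_card (partition_big f (mem B)) //=.
rewrite -sum_nat_const; apply: eq_bigr => y /fib <-.
by rewrite -sum1_card; apply: eq_bigl => x; rewrite !inE.
Qed.

Lemma leq_card_fibers (aT rT : finType) (A : {set aT}) (f : aT -> rT) n :
  {in A, forall y, #|[set x in A | f x == f y]| <= n}%N ->
  (#|A| <= #|f @: A| * n)%N.
Proof.
move=> fib; rewrite -sum1_card (partition_big f (mem (f @: A))) /=; last first.
  by move=> x Ax; apply: imset_f.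
rewrite -sum_nat_const; apply: leq_sum => _ /imsetP[y /fib + ->].
apply: leq_trans; rewrite -sum1_card; apply: eq_leq.
by apply: eq_bigl => x; rewrite !inE.
Qed.

(** * Finite chain rings *)

Section ChainRing.
Variables (R : finComUnitRingType) (p : R) (l : nat).
Hypothesis hR : chain_ring p l.

Definition pideal (j : nat) : {set R} := [set p ^+ j * x | x : R].

Lemma pidealP j x : reflect (exists y, x = p ^+ j * y) (x \in pideal j).
Proof.
apply: (iffP imsetP) => [[y _ ->]|[y ->]]; first by exists y.
by exists y.
Qed.

Lemma mem_pideal j x : p ^+ j * x \in pideal j.
Proof. by apply/pidealP; exists x. Qed.

Lemma pideal_0 j : 0 \in pideal j.
Proof. by apply/pidealP; exists 0; rewrite mulr0. Qed.

Lemma pidealD j : {in pideal j &, forall x y, x + y \in pideal j}.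
Proof.
by move=> _ _ /pidealP[x ->] /pidealP[y ->]; rewrite -mulrDr mem_pideal.
Qed.

Lemma pidealN j x : (- x \in pideal j) = (x \in pideal j).
Proof.
by apply/pidealP/pidealP => -[y e]; exists (- y); rewrite mulrN -e ?opprK.
Qed.

Lemma pidealB j : {in pideal j &, forall x y, x - y \in pideal j}.
Proof. by move=> x y hx hy; rewrite pidealD ?pidealN. Qed.

Lemma pidealMr j x y : x \in pideal j -> x * y \in pideal j.
Proof. by case/pidealP=> z ->; rewrite -mulrA mem_pideal. Qed.

Lemma pidealMl j x y : y \in pideal j -> x * y \in pideal j.
Proof. by rewrite mulrC; apply: pidealMr. Qed.

Lemma pidealMunit j x u : u \is a GRing.unit ->
  (x * u \in pideal j) = (x \in pideal j).
Proof.
move=> uu; apply/idP/idP; last exact: pidealMr.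
by move/pidealMr=> /(_ u^-1); rewrite mulrK.
Qed.

Lemma pidealMul i j x y : x \in pideal i -> y \in pideal j ->
  x * y \in pideal (i + j).
Proof.
move=> /pidealP[a ->] /pidealP[b ->]; rewrite mulrACA -exprD.
exact: mem_pideal.
Qed.

Lemma pideal_le i j x : (i <= j)%N -> x \in pideal j -> x \in pideal i.
Proof.
move=> ij /pidealP[y ->]; rewrite -(subnKC ij) exprD -mulrA; exact: mem_pideal.
Qed.

Lemma pideal_eq0 j x : (l <= j)%N -> x \in pideal j -> x = 0.
Proof.
case: hR => _ _ pl _ lj /(pideal_le lj) /pidealP[y ->].
by rewrite pl mul0r.
Qed.

Lemma pideal_mul0 i j x y : (l <= i + j)%N -> x \in pideal i ->
  y \in pideal j -> x * y = 0.
Proof. by move=> lij hx hy; apply: (pideal_eq0 lij); apply: pidealMul. Qed.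

Lemma pideal0T x : x \in pideal 0.
Proof. by apply/pidealP; exists x; rewrite expr0 mul1r. Qed.

Lemma pideal1_nunit x : (x \in pideal 1) = (x \isn't a GRing.unit).
Proof.
case: hR => l_gt0 nu pl _; apply/pidealP/idP => [[y ->]|/nu].
  rewrite expr1 unitrM; apply/negP => /andP[up _].
  by have := unitrX l up; rewrite pl unitr0.
by case=> y ->; exists y; rewrite expr1.
Qed.

Lemma unit_add_pideal x y : x \in pideal 1 ->
  (x + y \is a GRing.unit) = (y \is a GRing.unit).
Proof.
move=> hx; apply/idP/idP; apply: contraLR; rewrite -!pideal1_nunit => hy.
  exact: pidealD.
by rewrite -(addKr x y) pidealD ?pidealN.
Qed.

(** This plays the role of a valuation truncated at [j]: as long as the cofactor of a power of [p]
    is a nonunit, one more factor [p] can be extracted. *)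
Lemma pideal_or_unit_power j x : x \in pideal j \/
  exists i u, [/\ (i < j)%N, u \is a GRing.unit & x = p ^+ i * u].
Proof.
elim: j => [|j [/pidealP[y ->]|[i [u [ij uu ->]]]]]; first by left; apply: pideal0T.
  have [uy|nuy] := boolP (y \is a GRing.unit); first by right; exists j, y.
  left; rewrite -addn1; apply: pidealMul; last by rewrite pideal1_nunit.
  by rewrite -[p ^+ j]mulr1 mem_pideal.
by right; exists i, u; rewrite ltnS ltnW.
Qed.

Lemma exprp_eq0 j : p ^+ j = 0 -> (l <= j)%N.
Proof.
case: hR => l_gt0 _ _ pl1 pj; rewrite leqNgt; apply: contraNN pl1 => jl.
by rewrite (_ : l.-1 = j + (l.-1 - j))%N ?exprD ?pj ?mul0r //; lia.
Qed.

Lemma annihilator_pideal j x : p ^+ j * x = 0 -> x \in pideal (l - j).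
Proof.
move=> px; have [//|[i [u [ij uu xE]]]] := pideal_or_unit_power (l - j) x.
move: px; rewrite xE mulrA -exprD => /(congr1 (fun y => y * u^-1)).
by rewrite mulrK // mul0r => /exprp_eq0; lia.
Qed.

(** Multiplication by [p] maps [pideal j] onto [pideal j.+1], and its fibres are cosets of
    [pideal l.-1], the annihilator of [p]. Hence all successive indices of the filtration agree. *)
Lemma card_pideal_succ j : (j < l)%N ->
  #|pideal j| = (#|pideal j.+1| * #|pideal l.-1|)%N.
Proof.
move=> jl; apply: (@card_fibers _ _ _ _ (fun x => p * x)).
  by move=> _ /pidealP[x ->]; rewrite mulrA -exprS mem_pideal.
move=> _ /pidealP[y ->].
have -> : [set x in pideal j | p * x == p ^+ j.+1 * y]
  = [set p ^+ j * y + z | z in pideal l.-1].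
  apply/setP => x; rewrite inE; apply/andP/imsetP => [[xj /eqP px]|[z hz ->]].
    exists (x - p ^+ j * y); last by rewrite addrC subrK.
    rewrite -subn1; apply: annihilator_pideal.
    by rewrite expr1 mulrBr px mulrA -exprS subrr.
  split; first by rewrite pidealD ?mem_pideal // (pideal_le _ hz); lia.
  rewrite mulrDr (@pideal_mul0 1 l.-1 p z) ?addr0 ?mulrA -?exprS //; first lia.
  by apply/pidealP; exists 1; rewrite mulr1.
by rewrite card_imset //; apply: addrI.
Qed.

Lemma card_pideal_last j : (j <= l)%N -> #|pideal j| = (#|pideal l.-1| ^ (l - j))%N.
Proof.
move=> jl; rewrite -{1}(subKn jl); have := leq_subr j l.
elim: (l - j)%N => [_|i IH il].
  rewrite subn0 expn0; apply/eqP/cards1P; exists 0; apply/setP => x.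
  rewrite inE; apply/idP/eqP => [/pideal_eq0-> //|->]; exact: pideal_0.
rewrite card_pideal_succ; last lia.
by rewrite (_ : (l - i.+1).+1 = l - i)%N ?IH ?expnSr //; lia.
Qed.

Lemma card_pideal0 : #|pideal 0| = #|R|.
Proof. by rewrite -cardsT; apply: eq_card => x; rewrite !inE pideal0T. Qed.

Lemma resqE : resq p = #|pideal l.-1|.
Proof.
case: hR => l_gt0 _ _ _.
rewrite /resq -card_pideal0 card_pideal_succ //.
rewrite (_ : [set p * x | x : R] = pideal 1) ?mulKn //.
by apply/card_gt0P; exists 0; apply: pideal_0.
Qed.

Lemma card_pideal j : (j <= l)%N -> #|pideal j| = (resq p ^ (l - j))%N.
Proof. by rewrite resqE; apply: card_pideal_last. Qed.

Lemma card_chain_ring : #|R| = (resq p ^ l)%N.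
Proof. by rewrite -card_pideal0 card_pideal ?subn0. Qed.

Lemma resq_gt0 : (0 < resq p)%N.
Proof. by rewrite resqE; apply/card_gt0P; exists 0; apply: pideal_0. Qed.

Lemma card_units : (#|[set x : R | x \is a GRing.unit]| = (resq p - 1) * resq p ^ l.-1)%N.
Proof.
have l_gt0 : (0 < l)%N by case: hR.
have : (#|[set x : R | x \is a GRing.unit]| + #|pideal 1| = #|R|)%N.
  rewrite -(cardsC (pideal 1)) addnC; congr (_ + _)%N.
  by apply: eq_card => x; rewrite !inE pideal1_nunit negbK.
rewrite card_pideal // card_chain_ring mulnBl mul1n -expnS prednK // subn1.
by move=> <-; rewrite addnK.
Qed.

Lemma odd_resq_gt2 : odd (resq p) -> (2 < resq p)%N.
Proof.
have l_gt0 : (0 < l)%N by case: hR.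
move=> oq; have : (resq p != 1)%N; last by move: oq; case: (resq p) => [|[|[|]]].
apply/eqP => q1; have : (1 : R) = 0.
  have : (#|R| = 1)%N by rewrite card_chain_ring q1 exp1n.
  by move/eqP/fintype1P => [x hx]; rewrite (hx 0) (hx 1).
by apply/eqP; rewrite oner_neq0.
Qed.

(** If 2 lay in the maximal ideal, that ideal together with its translate by 1 would be an additive
    subgroup twice as large. By Lagrange its order would divide [#|R|], and [resq p] would be
    even. *)
Lemma odd_resq_unit2 : odd (resq p) -> 2%:R \is a @GRing.unit R.
Proof.
have l_gt0 : (0 < l)%N by case: hR.
apply: contraLR; rewrite -pideal1_nunit => h2.
have M0 : group_set (pideal 1).
  apply/group_setP; split; first exact: pideal_0.
  by move=> x y hx hy; apply: pidealD.
have N0 : group_set (pideal 1 :|: [set 1 + x | x in pideal 1]).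
  apply/group_setP; split; first by rewrite inE pideal_0.
  move=> x y; rewrite !inE => /orP[hx|/imsetP[x' hx ->]] /orP[hy|/imsetP[y' hy ->]].
  - by apply/orP; left; apply: pidealD.
  - apply/orP; right; apply/imsetP; exists (x + y'); first exact: pidealD.
    by rewrite /mulg /= addrCA.
  - apply/orP; right; apply/imsetP; exists (x' + y); first exact: pidealD.
    by rewrite /mulg /= addrA.
  - apply/orP; left; rewrite /mulg /= addrACA.
    by apply: pidealD; [exact: h2 | exact: pidealD].
have dis : pideal 1 :&: [set 1 + x | x in pideal 1] = set0.
  apply/setP => x; rewrite !inE; apply/negP => /andP[hx /imsetP[y hy xE]].
  have : 1 \in pideal 1 by rewrite -(addrK y 1) -xE pidealB.
  by rewrite pideal1_nunit unitr1.
have := cardsUI (pideal 1) [set 1 + x | x in pideal 1].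
rewrite dis cards0 addn0 (card_imset (mem (pideal 1)) (addrI 1)).
move=> cN; have := cardSg (subsetT (Group N0)); rewrite /= cN cardsT.
rewrite card_pideal // card_chain_ring addnn -muln2.
rewrite -{2}(subnKC l_gt0) expnD expn1 mulnC dvdn_pmul2r ?dvdn2 //.
by rewrite expn_gt0 resq_gt0.
Qed.

(** If [x] had a valuation [i] below [l - j], the multiples of [x] by [pideal j] would fill
    [pideal l.-1], where [f] is not constantly 1. *)
Lemma character_nondegenerate (f : R -> algC) j x :
  (exists a, f (p ^+ l.-1 * a) != 1) -> (j <= l)%N ->
  (forall z, z \in pideal j -> f (x * z) = 1) -> x \in pideal (l - j).
Proof.
move=> [a fa] jl fx; have [//|[i [u [ij uu xE]]]] := pideal_or_unit_power (l - j) x.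
case/eqP: fa; rewrite -(fx (p ^+ (l.-1 - i) * (u^-1 * a))).
  rewrite xE mulrACA -exprD subnKC ?mulVKr //; lia.
by apply: (@pideal_le _ (l.-1 - i)); rewrite ?mem_pideal //; lia.
Qed.

(** Hensel's lemma for squares, by counting. The map [w] to [(1 + w)^2 - 1] is injective on the
    maximal ideal, since the difference of two values is [(v - w) (v + w + 2)] with a unit as second
    factor; by finiteness it is onto. *)
Lemma square_of_square_mod x y : odd (resq p) -> y \is a GRing.unit ->
  y - x ^+ 2 \in pideal 1 -> exists z, z ^+ 2 = y.
Proof.
move=> oq uy yx; have u2 := odd_resq_unit2 oq.
have ux : x \is a GRing.unit.
  have : x ^+ 2 \is a GRing.unit.
    by rewrite -(unit_add_pideal (x ^+ 2) yx) subrK.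
  by rewrite unitrX_pos.
pose f w : R := w * (2%:R + w).
have fin : {in pideal 1 &, injective f}.
  move=> v w hv hw /eqP; rewrite -subr_eq0.
  rewrite (_ : f v - f w = (v - w) * (v + (w + 2%:R))); last by rewrite /f; ring.
  have uvw : v + (w + 2%:R) \is a GRing.unit.
    by rewrite (unit_add_pideal _ hv) (unit_add_pideal _ hw).
  move/eqP/(congr1 (fun t => t / (v + (w + 2%:R)))).
  rewrite (mulrK uvw) mul0r => /eqP.
  by rewrite subr_eq0 => /eqP.
have fim : f @: pideal 1 = pideal 1.
  apply/eqP; rewrite eqEcard card_in_imset // leqnn andbT.
  by apply/subsetP => _ /imsetP[w hw ->]; apply: pidealMr.
have : y / x ^+ 2 - 1 \in f @: pideal 1.
  by rewrite fim -(divrr (unitrX 2 ux)) -mulrBl pidealMr.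
case/imsetP => w hw /eqP; rewrite /f subr_eq => /eqP e.
exists (x * (1 + w)); rewrite -(divrK (unitrX 2 ux) y) e.
by rewrite exprMn; ring.
Qed.

End ChainRing.

(** * Induced and linear characters *)

Section CharacterTheory.
Variable gT : finGroupType.
Implicit Types G H : {group gT}.

Lemma linear_char_of_morphism H (f : gT -> algC) :
  f 1%g = 1 -> {in H &, {morph f : x y / (x * y)%g >-> x * y}} ->
  exists2 xi : 'CF(H), xi \is a linear_char & {in H, xi =1 f}.
Proof.
move=> f1 fM.
have rP : mx_repr H (fun x => (f x)%:M : 'M[algC]_1).
  split=> [|x y Hx Hy]; first by rewrite f1.
  by rewrite fM // -scalar_mxM.
pose xi := cfRepr (MxRepresentation rP).
have xiE : {in H, xi =1 f}.
  by move=> x Hx; rewrite cfunE Hx mulr1n /= mxtrace_scalar mulr1n.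
exists xi => //.
by rewrite qualifE /= cfRepr_char xiE ?group1 // f1 eqxx.
Qed.

(** Mackey's criterion. In the norm of the induced character each [g] in [H] contributes [#|H|]. For
    [g] outside [H], the substitution of [h0 * h] for [h] multiplies the inner sum by [xi (h0 ^ g)]
    times the conjugate of [xi h0], a scalar different from 1, so that sum vanishes. *)
Lemma Ind_lin_irr G H (xi : 'CF(H)) : H \subset G -> xi \is a linear_char ->
  (forall g, g \in G -> g \notin H ->
     exists h, [/\ h \in H, (h ^ g)%g \in H & xi (h ^ g)%g != xi h]) ->
  'Ind[G] xi \in irr G.
Proof.
move=> sHG lxi mackey; have chxi := lin_charW lxi.
rewrite irrEchar cfInd_char //= -cfdot_Res_l cfdotE.
have H0 : #|H|%:R != 0 :> algC by rewrite neq0CG.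
under eq_bigr => h Hh do rewrite cfResE // cfIndE // -mulrA big_distrl /=.
rewrite -big_distrr /= exchange_big /= (big_setID H) /= (setIidPr sHG).
rewrite [X in _ + X]big1 ?addr0 => [|g /setDP[Gg Hg]]; last first.
  have [h0 [Hh0 Hh0g neq]] := mackey g Gg Hg.
  set s := \sum_(_ in _) _.
  have : s = xi (h0 ^ g)%g * (xi h0)^* * s.
    rewrite /s big_distrr (reindex_inj (mulgI h0)) /=.
    apply: eq_big => h; first by rewrite groupMl.
    rewrite groupMl // => Hh; rewrite conjMg (lin_charM lxi Hh0 Hh) rmorphM.
    have [Hhg|Hhg] := boolP ((h ^ g)%g \in H).
      by rewrite (lin_charM lxi Hh0g Hhg) mulrACA.
    have Hh0hg : (h0 ^ g * h ^ g)%g \notin H by rewrite (groupMl _ Hh0g).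
    by rewrite (cfun0 xi Hhg) (cfun0 xi Hh0hg) !mul0r mulr0.
  move/eqP; rewrite -subr_eq0 -{1}[s]mul1r -mulrBl mulf_eq0 => /orP[|/eqP//].
  rewrite subr_eq0 => /eqP e; case/eqP: neq.
  have := congr1 (fun t => t * xi h0) e.
  rewrite mul1r -mulrA [_^* * _]mulrC -normCK normC_lin_char //.
  by rewrite expr1n mulr1 => ->.
rewrite (eq_bigr (fun=> #|H|%:R)) => [|g Hg]; last first.
  rewrite -sum1_card natr_sum; apply: eq_bigr => h Hh.
  rewrite cfunJ // -normCK normC_lin_char // expr1n //.
by rewrite sumr_const -(mulr_natl #|H|%:R) mulKf ?mulVf.
Qed.

Lemma cfdot_ge_common_constt H (phi psi : 'CF(H)) (X : {set Iirr H}) :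
  phi \is a character -> psi \is a character ->
  {in X, forall i, i \in irr_constt phi /\ i \in irr_constt psi} ->
  #|X|%:R <= '[phi, psi].
Proof.
move=> chphi chpsi hX; rewrite cfdot_sum_irr (bigID (mem X)) /=.
have nn i : 0 <= '[phi, 'chi_i] * '[psi, 'chi_i]^*.
  by rewrite mulr_ge0 ?conjC_ge0 // natr_ge0 // Cnat_cfdot_char ?irr_char.
rewrite -[_%:R]addr0 lerD ?sumr_ge0 //.
rewrite -sum1_card natr_sum ler_sum // => i /hX[].
rewrite !irr_consttE.
have /natrP[m ->] := Cnat_cfdot_char chphi (irr_char i).
have /natrP[n ->] := Cnat_cfdot_char chpsi (irr_char i).
rewrite !pnatr_eq0 conjC_nat -natrM ler_nat; lia.
Qed.

End CharacterTheory.

(** * Twists of the Steinberg character *)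

(* [L] is the unipotent radical of a Borel subgroup [P] of a rank one group [G]
   over a field with [q] elements. A character of [P] of degree [d] splits as
   [d = a + (q - 1) b], where [a] and [b] are the multiplicities in its
   restriction to [L] of the trivial and of any nontrivial linear character. *)
Section Steinberg.
Variables (gT : finGroupType) (G P L : {group gT}) (q : nat) (xi : 'CF(L)).
Hypotheses (sPG : P \subset G) (nLP : (L <| P)%g) (oL : #|L| = q)
  (q_gt2 : (2 < q)%N) (iPG : #|G : P|%g = q.+1)
  (trP : {in L^# &, forall x y, exists2 g, g \in P & y = x ^ g}%g)
  (lxi : xi \is a linear_char) (xi_neq1 : xi != 1)
  (kerlin : forall i : Iirr G, L \subset cfker 'chi_i ->
     'chi_i \is a linear_char).

Let sLP : L \subset P := normal_sub nLP.
Let mult1 (phi : 'CF(P)) := '['Res[L] phi, 1].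
Let multxi (phi : 'CF(P)) := '['Res[L] phi, xi].

Let q0 : q%:R != 0 :> algC. Proof. by rewrite pnatr_eq0; lia. Qed.

Let q1 : (q == 1)%N = false. Proof. by move: q_gt2; case: q => [|[|]]. Qed.

Let cfun_const (phi : 'CF(P)) x y : x \in L^#%g -> y \in L^#%g -> phi x = phi y.
Proof. by move=> Lx Ly; have [g Pg ->] := trP Lx Ly; rewrite cfunJ. Qed.

Let sum_cfun_const (phi : 'CF(P)) (psi : 'CF(L)) x : x \in L^#%g ->
  '['Res[L] phi, psi] = q%:R^-1 * (phi 1%g * (psi 1%g)^* +
    phi x * (\sum_(y in L^#%g) psi y)^*).
Proof.
move=> Lx; rewrite cfdotE oL (big_setD1 1%g) //= cfResE ?group1 //.
rewrite rmorph_sum /= big_distrr /=; congr (_ * (_ + _)).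
apply: eq_bigr => y Ly; rewrite cfResE ?(cfun_const _ Lx Ly) //.
by case/setD1P: Ly.
Qed.

Let exL : exists x, x \in L^#%g.
Proof.
apply/set0Pn; rewrite -card_gt0.
have := cardsD1 1%g L; rewrite group1 oL add1n => e; rewrite -ltnS -e.
by apply: ltnW.
Qed.

Let multxiE (phi : 'CF(P)) x : x \in L^#%g ->
  multxi phi = q%:R^-1 * (phi 1%g - phi x).
Proof.
move=> Lx; rewrite /multxi (sum_cfun_const _ _ Lx) (lin_char1 lxi) conjC1 mulr1.
have : '[xi, 1] = 0.
  have /irrP[i iE] := lin_char_irr lxi.
  rewrite iE -irr0 cfdot_irr; case: eqP => // i0.
  by case/eqP: xi_neq1; rewrite iE i0 irr0.
rewrite cfdotE (big_setD1 1%g) //= => /eqP; rewrite mulf_eq0 invr_eq0 oL.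
rewrite (negPf q0) /= (lin_char1 lxi) cfun1E group1 conjC_nat mulr1 addrC.
rewrite (eq_bigr xi) => [|y /setD1P[_ Ly]]; last by rewrite cfun1E Ly conjC_nat mulr1.
rewrite addr_eq0 => /eqP ->. by rewrite rmorphN rmorph1 mulrN1.
Qed.

(** A class function of [P] is constant on [L] minus 1, so its restriction to [L] is a combination
    of the trivial and the regular character of [L]. *)
Let degree_mult (phi : 'CF(P)) :
  phi 1%g = mult1 phi + (q - 1)%:R * multxi phi.
Proof.
have [x Lx] := exL; rewrite (multxiE _ Lx) /mult1 (sum_cfun_const _ _ Lx).
rewrite cfun1E group1 conjC_nat mulr1 (eq_bigr (fun=> 1)); last first.
  by move=> y /setD1P[_ Ly]; rewrite cfun1E Ly.
rewrite sumr_const conjC_nat (_ : #|_| = q - 1)%N; last first.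
  by move: oL; rewrite (cardsD1 1%g) group1 => <-; rewrite addKn.
rewrite natrB; last lia.
by field; apply: q0.
Qed.

Let mult1D : {morph mult1 : x y / x + y}.
Proof. by move=> x y; rewrite /mult1 linearD cfdotDl. Qed.
Let multxiD : {morph multxi : x y / x + y}.
Proof. by move=> x y; rewrite /multxi linearD cfdotDl. Qed.
Let mult1_nat phi : phi \is a character -> exists n, mult1 phi = n%:R.
Proof.
by move=> ch; apply/natrP; rewrite Cnat_cfdot_char ?cfRes_char ?cfun1_char.
Qed.
Let multxi_nat phi : phi \is a character -> exists n, multxi phi = n%:R.
Proof.
move=> ch; apply/natrP.
by apply: Cnat_cfdot_char; [exact: cfRes_char | exact: lin_charW].
Qed.

(** By Frobenius reciprocity ['chi_i] is a constituent of the trivial character of [L] induced to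
    [P], whose kernel contains the normal subgroup [L]. *)
Let mult1_ker (i : Iirr P) : mult1 'chi_i != 0 -> L \subset cfker 'chi_i.
Proof.
rewrite /mult1 cfdot_Res_l => ne0.
have chI : 'Ind[P] (1 : 'CF(L)) \is a character by rewrite cfInd_char ?cfun1_char.
apply: subset_trans (cfker_constt chI _); last first.
  by rewrite irr_consttE cfdotC conjC_eq0.
rewrite cfker_Ind ?cfun1_char ?oner_eq0 // cfker_cfun1 sub_gcore ?normal_norm //.
Qed.

(** Write [q = a + (q - 1) b]. If [b = 0], then [L] lies in the kernel and ['chi_i] is linear,
    against its degree; so [a = b = 1], as [q > 2]. The constituent with a vector fixed by [L] is
    trivial on [L], hence linear. The rest has [a = 0] and [b = 1], so it cannot split further. *)
Let steinberg_Res (i : Iirr G) : 'chi_i 1%g = q%:R ->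
  exists j k : Iirr P, [/\ 'chi_j \is a linear_char,
    'Res[P] 'chi_i = 'chi_j + 'chi_k, mult1 'chi_j = 1 & mult1 'chi_k = 0].
Proof.
move=> deg; set phi := 'Res[P] 'chi_i.
have chphi : phi \is a character by rewrite cfRes_char ?irr_char.
have dphi : phi 1%g = q%:R by rewrite cfRes1.
have [x Lx] := exL; have [a aE] := mult1_nat chphi; have [b bE] := multxi_nat chphi.
have b0 : b != 0%N.
  apply/eqP => b0; move: (multxiE phi Lx); rewrite bE b0 => /esym/eqP.
  rewrite mulf_eq0 invr_eq0 (negPf q0) /= subr_eq0 => /eqP e.
  have : 'chi_i \is a linear_char.
    apply: kerlin; apply/subsetP => y Ly; rewrite cfkerEchar ?irr_char // inE.
    rewrite (subsetP sPG) ?(subsetP sLP) //=.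
    have [->//|y1] := eqVneq y 1%g.
    have Ly' : y \in L^#%g by rewrite !inE y1.
    rewrite -(cfResE _ sPG) ?(subsetP sLP) // -(cfResE _ sPG (group1 P)) -/phi.
    by rewrite (cfun_const phi Ly' Lx) e.
  by move/lin_char1/eqP; rewrite deg pnatr_eq1 q1.
have : phi 1%g = (a + (q - 1) * b)%N%:R.
  by rewrite degree_mult aE bE natrD natrM.
rewrite dphi => /eqP; rewrite eqr_nat => /eqP qab.
have {qab b0} [a1 b1] : a = 1%N /\ b = 1%N.
  have b1 : b = 1%N by case: b b0 qab {bE} => [|[|b]] // _; nia.
  by rewrite b1 muln1 in qab *; split=> //; lia.
rewrite {}a1 {}b1 in aE bE.
have [j jphi j0] : exists2 j, j \in irr_constt phi & mult1 'chi_j != 0.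
  apply/exists_inP; apply: contraT => /exists_inPn none.
  suff : mult1 phi = 0 by rewrite aE => /eqP; rewrite oner_eq0.
  rewrite /mult1 {1}(cfun_sum_cfdot phi) linear_sum cfdot_suml big1 // => j _.
  rewrite linearZ cfdotZl; have [/none/negPn/eqP|] := boolP (j \in irr_constt phi).
    by rewrite /mult1 => ->; rewrite mulr0.
  by rewrite irr_consttE negbK => /eqP ->; rewrite mul0r.
have [psi chpsi phiE] := constt_charP _ chphi jphi.
have [c cE] := mult1_nat (irr_char j); have [c' cE'] := mult1_nat chpsi.
have [d dE] := multxi_nat chpsi.
have kerj := mult1_ker j0.
have xij : multxi 'chi_j = 0.
  rewrite (multxiE _ Lx) cfker1 ?subrr ?mulr0 // (subsetP kerj) //.
  by case/setD1P: Lx.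
have := mult1D 'chi_j psi; rewrite -phiE aE cE cE' -natrD => /eqP.
rewrite cE pnatr_eq0 in j0; rewrite eqr_nat => /eqP cc.
have c1 : c = 1%N by lia. have c'0 : c' = 0%N by lia.
rewrite c1 in cE; rewrite c'0 in cE'.
have := multxiD 'chi_j psi; rewrite -phiE bE xij add0r => /esym xipsi.
have linj : 'chi_j \is a linear_char.
  by rewrite qualifE /= irr_char degree_mult xij cE mulr0 addr0 eqxx.
have psi0 : psi != 0.
  by apply/eqP => psi0; move: xipsi; rewrite /multxi psi0 linear0 cfdot0l => /eqP; rewrite eq_sym oner_eq0.
have [k kpsi] := neq0_has_constt psi0.
have [psi' chpsi' psiE] := constt_charP _ chpsi kpsi.
have [e eE] := mult1_nat (irr_char k); have [e' eE'] := mult1_nat chpsi'.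
have [f fE] := multxi_nat (irr_char k); have [f' fE'] := multxi_nat chpsi'.
have := mult1D 'chi_k psi'; rewrite -psiE cE' eE eE' -natrD => /eqP.
rewrite eqr_nat eq_sym addn_eq0 => /andP[/eqP e0 /eqP e'0].
have := multxiD 'chi_k psi'; rewrite -psiE xipsi fE fE' -natrD => /eqP.
rewrite (eqr_nat _ 1) => /eqP ff.
have f0 : f != 0%N.
  apply: contraNN (irr1_neq0 k) => /eqP f0; rewrite degree_mult eE fE f0 mulr0 addr0.
  by rewrite e0.
exists j, k; split=> //; last by rewrite eE e0.
rewrite phiE psiE; congr (_ + _); rewrite -[RHS]addr0; congr (_ + _).
apply/eqP; rewrite -(char1_eq0 chpsi') degree_mult eE' fE' -natrM -natrD pnatr_eq0.
have -> : f' = 0%N by move: f0 ff; clear; lia.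
by rewrite e'0 muln0.
Qed.

(** The induced character has degree [q + 1] and contains ['chi_i], which leaves a complement of
    degree 1; reciprocity then identifies its restriction to [P]. *)
Let steinberg_Ind (i : Iirr G) (j : Iirr P) : 'chi_i 1%g = q%:R ->
  'chi_j \is a linear_char -> '['Res[P] 'chi_i, 'chi_j] != 0 ->
  exists2 alpha : 'CF(G), alpha \is a linear_char &
    'Ind[G] 'chi_j = 'chi_i + alpha /\ 'Res[P] alpha = 'chi_j.
Proof.
move=> deg linj ij.
have chI : 'Ind[G] 'chi_j \is a character by rewrite cfInd_char ?irr_char.
have iI : i \in irr_constt ('Ind[G] 'chi_j).
  by rewrite irr_consttE cfdotC conjC_eq0 -cfdot_Res_l.
have [alpha chalpha IE] := constt_charP i chI iI.
have lalpha : alpha \is a linear_char.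
  rewrite qualifE /= chalpha; have := cfInd1 'chi_j sPG.
  rewrite IE cfunE deg iPG (lin_char1 linj) mulr1 -natr1 => /addrI ->.
  by rewrite eqxx.
exists alpha => //; split=> //.
have /irrP[k kE] := lin_char_irr (cfRes_lin_char P lalpha).
rewrite kE; congr 'chi_ _; apply/eqP; apply: contraT => jk.
have : '['Ind[G] 'chi_j, alpha] = 0.
  by rewrite -cfdot_Res_r kE cfdot_irr eq_sym (negPf jk).
have /natrP[n nE] := Cnat_cfdot_char (irr_char i) chalpha.
rewrite IE cfdotDl nE (irrWnorm (lin_char_irr lalpha)) natr1 => /eqP.
by rewrite pnatr_eq0.
Qed.

Lemma steinberg_mult_le1 (i j k : Iirr G) : 'chi_i 1%g = q%:R ->
  'chi_j 1%g = q%:R -> 'chi_k 1%g = q%:R -> '['chi_i * 'chi_j, 'chi_k] <= 1.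
Proof.
move=> di dj dk.
(* The value of [mult1] tells the linear summand of such a restriction apart from the other one, so
   products between the two kinds vanish. *)
have dotj (s t t' : Iirr P) phi : phi = 'chi_t + 'chi_t' -> mult1 'chi_s = 1 ->
    mult1 'chi_t' = 0 -> '[phi, 'chi_s] = (t == s)%:R.
  move=> -> s1 t0; rewrite cfdotDl !cfdot_irr [t' == s](_ : _ = false) ?addr0 //.
  apply/eqP => ts; move: t0; rewrite ts s1 => /eqP; by rewrite oner_eq0.
have [k1 [k2 [lk1 RkE k11 k20]]] := steinberg_Res dk.
have [|alpha lalpha [IkE Ralpha]] := steinberg_Ind dk lk1.
  by rewrite (dotj _ _ _ _ RkE) // eqxx oner_eq0.
have /irrP[j' j'E] : alpha * ('chi_j)^*%CF \in irr G.
  by rewrite mul_lin_irr ?cfConjC_irr.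
have dj' : 'chi_j' 1%g = q%:R.
  by rewrite -j'E cfunE lin_char1 // mul1r cfunE /= dj conjC_nat.
have move_conj (phi : 'CF(G)) : '['chi_i * 'chi_j, alpha * phi] = '['chi_i, 'chi_j' * phi].
  rewrite !cfdotE; congr (_ * _); apply: eq_bigr => x _.
  by rewrite -j'E !cfunE !rmorphM /= conjCK; ring.
have dotE : '['chi_i * 'chi_j, 'chi_k] =
    '['Res[P] 'chi_i, 'Res[P] 'chi_j'] - '['chi_i, 'chi_j'].
  have -> : 'chi_k = 'Ind[G] 'chi_k1 - alpha by rewrite IkE addrK.
  rewrite cfdotBr -{1}Ralpha -cfdot_Res_l.
  have := move_conj 1; rewrite !mulr1 => ->.
  congr (_ - _); rewrite !cfdotE; congr (_ * _).
  by apply: eq_bigr => x Px; rewrite !cfResE // -j'E !cfunE rmorphM /= conjCK; ring.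
have [i1 [i2 [li1 RiE i11 i20]]] := steinberg_Res di.
have [s1 [s2 [ls1 RsE s11 s20]]] := steinberg_Res dj'.
(* If the linear parts agree, both characters of degree [q] occur in one induced character, which is
   ['chi_i] plus a linear character; comparing degrees leaves only [i = j']. *)
have is1 : i1 = s1 -> i = j'.
  move=> e.
  have [|a la [IiE _]] := steinberg_Ind di li1.
    by rewrite (dotj _ _ _ _ RiE) // eqxx oner_eq0.
  have [|b lb [IsE _]] := steinberg_Ind dj' ls1.
    by rewrite (dotj _ _ _ _ RsE) // eqxx oner_eq0.
  have /irrP[t tE] := lin_char_irr la.
  have tj' : t != j'.
    apply/eqP => tj; have := lin_char1 la; rewrite tE tj dj' => /eqP.
    by rewrite pnatr_eq1 q1.
  have : '['Ind[G] 'chi_i1, 'chi_j'] != 0.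
    rewrite e IsE cfdotDl cfnorm_irr.
    have /natrP[n ->] := Cnat_cfdot_char (lin_charW lb) (irr_char j').
    by rewrite nat1r pnatr_eq0.
  rewrite IiE tE cfdotDl !cfdot_irr (negPf tj') addr0.
  by have [//|_] := eqVneq i j'; rewrite eqxx.
rewrite dotE RsE cfdotDr (dotj _ _ _ _ RiE) // RiE cfdotDl !cfdot_irr.
have -> : (i1 == s2) = false.
  by apply/eqP => e; move: i11; rewrite e s20 => /eqP; rewrite eq_sym oner_eq0.
(* When the linear parts agree, the subtracted product is 1 and compensates their contribution;
   otherwise only the nonlinear parts can contribute. *)
rewrite add0r; have [/is1->|_] := eqVneq i1 s1.
  by rewrite eqxx addrC addKr; case: eqP.
rewrite add0r lerBlDr; apply: (@le_trans _ _ 1); last by rewrite lerDl ler0n.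
by case: eqP; rewrite ?ler01.
Qed.

End Steinberg.

(** * Entries of invertible matrices of size two *)

Section GL2.
Variable S : finComUnitRingType.
Implicit Types (g h : {'GL_2[S]}) (a b c d : S).

Definition ea g : S := (GLval g : 'M[S]_2) 0 0.
Definition eb g : S := (GLval g : 'M[S]_2) 0 1.
Definition ec g : S := (GLval g : 'M[S]_2) 1 0.
Definition ed g : S := (GLval g : 'M[S]_2) 1 1.
Definition edet g : S := ea g * ed g - eb g * ec g.

Lemma ord2P (k : 'I_2) : k = 0 \/ k = 1.
Proof. by case: k => [[|[|//]] ?]; [left|right]; apply/val_inj. Qed.

Lemma mulmx2E (A B : 'M[S]_2) i j :
  (A *m B) i j = A i 0 * B 0 j + A i 1 * B 1 j.
Proof.
by rewrite mxE big_ord_recl big_ord1; congr (_ * _ + A i _ * B _ j); apply/val_inj.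
Qed.

Lemma mx2P (A B : 'M[S]_2) : A 0 0 = B 0 0 -> A 0 1 = B 0 1 ->
  A 1 0 = B 1 0 -> A 1 1 = B 1 1 -> A = B.
Proof.
move=> e00 e01 e10 e11; apply/matrixP => i j.
by case: (ord2P i) => ->; case: (ord2P j) => ->.
Qed.

Lemma GL2_ext g h : ea g = ea h -> eb g = eb h -> ec g = ec h -> ed g = ed h ->
  g = h.
Proof. by move=> *; apply/val_inj; apply: mx2P. Qed.

Lemma eaM g h : ea (g * h)%g = ea g * ea h + eb g * ec h.
Proof. by rewrite /ea GL_MxE mulmx2E. Qed.
Lemma ebM g h : eb (g * h)%g = ea g * eb h + eb g * ed h.
Proof. by rewrite /eb GL_MxE mulmx2E. Qed.
Lemma ecM g h : ec (g * h)%g = ec g * ea h + ed g * ec h.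
Proof. by rewrite /ec GL_MxE mulmx2E. Qed.
Lemma edM g h : ed (g * h)%g = ec g * eb h + ed g * ed h.
Proof. by rewrite /ed GL_MxE mulmx2E. Qed.
Lemma ea1 : ea 1 = 1. Proof. by rewrite /ea GL_1E mxE. Qed.
Lemma eb1 : eb 1 = 0. Proof. by rewrite /eb GL_1E mxE. Qed.
Lemma ec1 : ec 1 = 0. Proof. by rewrite /ec GL_1E mxE. Qed.
Lemma ed1 : ed 1 = 1. Proof. by rewrite /ed GL_1E mxE. Qed.

Definition mulGL2E := (eaM, ebM, ecM, edM).
Definition oneGL2E := (ea1, eb1, ec1, ed1).

Lemma edetM g h : edet (g * h)%g = edet g * edet h.
Proof. by rewrite /edet !mulGL2E; ring. Qed.

Lemma edet_unit g : edet g \is a GRing.unit.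
Proof.
apply/unitrPr; exists (edet g^-1).
by rewrite -edetM mulgV /edet !oneGL2E; ring.
Qed.

Definition mx2 a b c d : 'M[S]_2 := \matrix_(i, j)
  if i == 0 then if j == 0 then a else b else if j == 0 then c else d.

(** A singular matrix is sent to the default value 1, so the entry lemmas below assume a unit
    determinant. *)
Definition gl2 a b c d : {'GL_2[S]} := 
  @insubd _ _ {'GL_2[S]} 1%g (mx2 a b c d).

Section Entries.
Variables (a b c d : S).
Hypothesis du : a * d - b * c \is a GRing.unit.

Lemma gl2val : GLval (gl2 a b c d) = mx2 a b c d.
Proof.
have uM : mx2 a b c d \in unitmx.
  have : mx2 a b c d *m mx2 d (- b) (- c) a \in unitmx.
    rewrite (_ : _ *m _ = (a * d - b * c)%:M) ?unitmxE ?det_scalar ?unitrX //.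
    by apply: mx2P; rewrite mulmx2E !mxE /=; ring.
  by rewrite unitmx_mul => /andP[].
exact: (@insubdK _ _ {'GL_2[S]} 1%g (mx2 a b c d) uM).
Qed.

Lemma ea_gl2 : ea (gl2 a b c d) = a. Proof. by rewrite /ea gl2val mxE. Qed.
Lemma eb_gl2 : eb (gl2 a b c d) = b. Proof. by rewrite /eb gl2val mxE. Qed.
Lemma ec_gl2 : ec (gl2 a b c d) = c. Proof. by rewrite /ec gl2val mxE. Qed.
Lemma ed_gl2 : ed (gl2 a b c d) = d. Proof. by rewrite /ed gl2val mxE. Qed.
Definition gl2E := (ea_gl2, eb_gl2, ec_gl2, ed_gl2).
End Entries.

(** Cramer's rule applied to [h * g = g * h ^ g]. The determinant is kept on the left, so that no
    inverse matrix is ever expanded. *)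
Lemma conjGL2 g h :
  [/\ edet g * ea (h ^ g)%g = ed g * ea (h * g)%g - eb g * ec (h * g)%g,
      edet g * eb (h ^ g)%g = ed g * eb (h * g)%g - eb g * ed (h * g)%g,
      edet g * ec (h ^ g)%g = ea g * ec (h * g)%g - ec g * ea (h * g)%g &
      edet g * ed (h ^ g)%g = ea g * ed (h * g)%g - ec g * eb (h * g)%g].
Proof.
rewrite (conjgC h g); set k := (h ^ g)%g.
by rewrite !mulGL2E /edet; split; ring.
Qed.
End GL2.

(** * Rank one groups of GL2-type *)

(* Shared by GL_2(R), with [S = R] and [w = 1], and by GU_2(R), with [S] the
   unramified quadratic extension of [R] and [w = theta]: in both cases the
   root subgroups are parametrised by [w^-1 R], and the ratio of the diagonal
   entries of the torus elements runs over all units of [R]. *)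
Record rank_one (R S : finComUnitRingType) (iota : {rmorphism R -> S}) (w : S)
    (G : {group {'GL_2[S]}}) : Prop := RankOne {
  rank_one_unit : w \is a GRing.unit;
  rank_one_div : forall x y, (exists s, iota x = iota y * s) ->
    exists z, x = y * z;
  rank_one_ac : {in G, forall g, exists r, w * ea g * ec g = iota r * edet g};
  rank_one_aa : {in G, forall g, exists r, ea g * ea g = iota r * edet g};
  rank_one_lower : forall y, gl2 1 0 (iota y / w) 1 \in G;
  rank_one_torus : forall t, t \is a GRing.unit ->
    exists2 u, u \is a GRing.unit & gl2 u 0 0 (iota t * u) \in G;
  rank_one_weyl : gl2 0 1 1 0 \in G;
  rank_one_diag : {in G, forall g, ec g = 0 -> gl2 (ea g) 0 0 (ed g) \in G}
}.

Section RankOne.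
Variables (R S : finComUnitRingType) (iota : {rmorphism R -> S}) (w : S).
Variables (G : {group {'GL_2[S]}}) (p : R) (l : nat).
Hypotheses (hR : chain_ring p l) (hS : chain_ring (iota p) l).
Hypothesis hG : rank_one iota w G.

Let uw : w \is a GRing.unit := rank_one_unit hG.
Local Notation I := (pideal (iota p)).
Local Notation J := (pideal p).

Lemma iota_inj : injective iota.
Proof.
move=> x y e; have [|z /eqP] := @rank_one_div _ _ _ _ _ hG (x - y) 0.
  by exists 0; rewrite rmorph0 mulr0 rmorphB e subrr.
by rewrite mul0r subr_eq0 => /eqP.
Qed.

Lemma iota_pideal j x : (iota x \in I j) = (x \in J j).
Proof.
apply/pidealP/pidealP => -[y e]; last first.
  by exists (iota y); rewrite e rmorphM rmorphXn.
by apply: (rank_one_div hG); exists y; rewrite rmorphXn.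
Qed.

Lemma iota_unit x : (iota x \is a GRing.unit) = (x \is a GRing.unit).
Proof.
apply: negb_inj; rewrite -(pideal1_nunit hS) -(pideal1_nunit hR).
exact: iota_pideal.
Qed.

Definition lower y : {'GL_2[S]} := gl2 1 0 (iota y / w) 1.
Definition upper y : {'GL_2[S]} := gl2 1 (iota y / w) 0 1.
Definition weyl : {'GL_2[S]} := gl2 0 1 1 0.

Let ul y : 1 * 1 - 0 * (iota y / w) \is a GRing.unit.
Proof. by rewrite mul0r subr0 mulr1 unitr1. Qed.
Let uu y : 1 * 1 - iota y / w * 0 \is a GRing.unit.
Proof. by rewrite mulr0 subr0 mulr1 unitr1. Qed.
Let uW : 0 * 0 - 1 * 1 \is a @GRing.unit S.
Proof. by rewrite mulr0 mulr1 sub0r unitrN1. Qed.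

Definition lowerE y := gl2E (ul y).
Definition upperE y := gl2E (uu y).
Definition weylE := gl2E uW.

Lemma diag_unit (x y : S) : x \is a GRing.unit -> y \is a GRing.unit ->
  x * y - 0 * 0 \is a GRing.unit.
Proof. by move=> ux uy; rewrite mulr0 subr0 unitrM ux. Qed.

Lemma lowerD y z : lower (y + z) = (lower y * lower z)%g.
Proof. by apply: GL2_ext; rewrite !mulGL2E !lowerE ?rmorphD /=; ring. Qed.

Lemma weylK : (weyl * weyl)%g = 1%g.
Proof. by apply: GL2_ext; rewrite !mulGL2E !weylE !oneGL2E; ring. Qed.

Lemma upperEweyl y : upper y = (weyl * lower y * weyl)%g.
Proof. by apply: GL2_ext; rewrite !mulGL2E !weylE !lowerE !upperE; ring. Qed.

Lemma upperD y z : upper (y + z) = (upper y * upper z)%g.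
Proof. by apply: GL2_ext; rewrite !mulGL2E !upperE ?rmorphD /=; ring. Qed.

Lemma weylG : weyl \in G. Proof. exact: (rank_one_weyl hG). Qed.
Lemma lowerG y : lower y \in G. Proof. exact: (rank_one_lower hG). Qed.
Lemma upperG y : upper y \in G.
Proof. by rewrite upperEweyl !groupM ?weylG ?lowerG. Qed.

(** The ratio is the quotient of the two elements of [R] provided by [rank_one_ac] and
    [rank_one_aa], in which the determinant cancels. *)
Lemma lower_ratio g : g \in G -> ea g \is a GRing.unit ->
  exists y, w * ec g = iota y * ea g.
Proof.
move=> Gg ua; have [r rE] := rank_one_ac hG Gg.
have [s sE] := rank_one_aa hG Gg.
have us : s \is a GRing.unit.
  rewrite -iota_unit; have : ea g * ea g \is a GRing.unit by rewrite unitrM ua.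
  by rewrite sE unitrM => /andP[].
exists (r / s); apply: (mulIr ua).
by rewrite mulrAC rE -mulrA sE mulrA -rmorphM divrK.
Qed.

Lemma diag_ratio g : g \in G -> ec g = 0 ->
  exists2 t, t \is a GRing.unit & ed g = iota t * ea g.
Proof.
move=> Gg c0; have [s sE] := rank_one_aa hG Gg.
have uD := edet_unit g; have DE : edet g = ea g * ed g by rewrite /edet c0; ring.
have /andP[ua ud] : (ea g \is a GRing.unit) && (ed g \is a GRing.unit).
  by rewrite -unitrM -DE.
have us : s \is a GRing.unit.
  rewrite -iota_unit; have : ea g * ea g \is a GRing.unit by rewrite unitrM ua.
  by rewrite sE unitrM => /andP[].
have aE : ea g = iota s * ed g by apply: (mulIr ua); rewrite sE DE; ring.
exists s^-1; first by rewrite unitrV.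
by rewrite aE mulrA -rmorphM mulVr // rmorph1 mul1r.
Qed.

(** Conjugation by the Weyl element moves the upper right entry to the lower left, where
    [lower_ratio] applies. *)
Lemma upper_unipotent g : g \in G -> ea g = 1 -> ec g = 0 -> ed g = 1 ->
  exists y, g = upper y.
Proof.
move=> Gg a1 c0 d1.
have [||y] := @lower_ratio (weyl * g * weyl)%g.
- by rewrite !groupM ?weylG.
- by rewrite !mulGL2E !weylE d1 !(mul0r, mul1r, mulr0, mulr1, add0r, addr0) unitr1.
rewrite !mulGL2E !weylE a1 c0 d1 !(mul0r, mul1r, mulr0, mulr1, add0r, addr0) => bE.
exists y; apply: GL2_ext; rewrite !upperE //; apply: (mulrI uw).
by rewrite bE mulrC divrK.
Qed.

(** * The Borel subgroup and the order of the group *)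

Definition borel : {set {'GL_2[S]}} := [set g in G | ec g == 0].

Lemma borel_group_set : group_set borel.
Proof.
apply/group_setP; split=> [|x y]; first by rewrite inE group1 oneGL2E eqxx.
rewrite !inE => /andP[Gx /eqP cx] /andP[Gy /eqP cy].
by rewrite groupM //= ecM cx cy mul0r mulr0 addr0 eqxx.
Qed.
Canonical borel_group := Group borel_group_set.

Lemma borel_sub : borel \subset G.
Proof. by apply/subsetP => g; rewrite inE => /andP[]. Qed.

Lemma borel_unit g : g \in borel ->
  ea g \is a GRing.unit /\ ed g \is a GRing.unit.
Proof.
rewrite inE => /andP[_ /eqP c0]; have := edet_unit g.
by rewrite /edet c0 mulr0 subr0 unitrM => /andP[].
Qed.

Lemma unit_of_ratio g y : w * ec g = iota y * ea g -> ea g \is a GRing.unit.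
Proof.
move=> yE; have := edet_unit g.
have -> : edet g = ea g * (ed g - eb g * iota y / w).
  apply: (mulrI uw); rewrite [RHS]mulrCA [in RHS]mulrBr [w * (_ / w)]mulrC divrK //.
  by rewrite /edet mulrBr mulrCA [w * (eb g * _)]mulrCA yE; ring.
by rewrite unitrM => /andP[].
Qed.

Lemma lower_clear g y : w * ec g = iota y * ea g ->
  ec (lower (- y) * g)%g = 0.
Proof.
move=> yE; rewrite !mulGL2E !lowerE; apply: (mulrI uw).
rewrite mulr0 mulrDr mul1r yE rmorphN mulrA (mulrC w) divrK //.
by rewrite mulNr addNr.
Qed.

(** The default 0 is harmless: [lratioE] is applied only where a ratio exists, and there it is
    unique. *)
Let lratio g : R := odflt 0 [pick y | w * ec g == iota y * ea g].

Let lratioE g y : w * ec g = iota y * ea g -> lratio g = y.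
Proof.
move=> yE; rewrite /lratio; case: pickP => [z /eqP|/(_ y)]; last by rewrite yE eqxx.
by rewrite yE => /(mulIr (unit_of_ratio yE))/iota_inj.
Qed.

(** Each [g] in [A] factors uniquely as [lower y * b] with [y] in [X] and [b] in [B]. The same count
    serves the big cell, the small cell and [polar]. *)
Lemma card_lower_mul (A B : {set {'GL_2[S]}}) (X : {set R}) :
  {in A, forall g, exists y, w * ec g = iota y * ea g} ->
  (forall g y, w * ec g = iota y * ea g ->
     (g \in A) = (y \in X) && ((lower (- y) * g)%g \in B)) ->
  {in B, forall g, ec g = 0} ->
  #|A| = (#|X| * #|B|)%N.
Proof.
move=> rA AB B0; apply: (@card_fibers _ _ _ _ lratio) => [g Ag|y Xy].
  have [y yE] := rA g Ag; rewrite (lratioE yE).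
  by move: Ag; rewrite (AB _ _ yE) => /andP[].
have lK z : (lower (- z) * lower z = 1)%g.
  by rewrite -lowerD addNr; apply: GL2_ext; rewrite !lowerE !oneGL2E ?rmorph0 ?mul0r.
rewrite (_ : [set g in A | _] = [set (lower y * b)%g | b in B]).
  by rewrite card_imset //; apply: mulgI.
apply/setP => g; rewrite inE; apply/andP/imsetP => [[Ag /eqP gy]|[b Bb ->]].
  have [z zE] := rA g Ag; move: gy; rewrite (lratioE zE) => zy.
  rewrite zy in zE; exists (lower (- y) * g)%g.
    by move: Ag; rewrite (AB _ _ zE) => /andP[].
  by have := lK (- y); rewrite opprK mulgA => ->; rewrite mul1g.
have yE : w * ec (lower y * b)%g = iota y * ea (lower y * b)%g.
  rewrite !mulGL2E !lowerE (B0 _ Bb) !mulr0 !addr0.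
  by rewrite mulrA (mulrC w) divrK // mul1r.
by rewrite (AB _ _ yE) Xy mulgA lK mul1g (lratioE yE).
Qed.

Let card_bigcell : (#|[set g in G | ea g \is a GRing.unit]| = #|R| * #|borel|)%N.
Proof.
rewrite -cardsT; apply: card_lower_mul => [g|g y yE|g].
- by rewrite inE => /andP[]; apply: lower_ratio.
- by rewrite !inE groupMl ?lowerG // (lower_clear yE) eqxx (unit_of_ratio yE).
- by rewrite inE => /andP[_ /eqP].
Qed.

Let card_smallcell :
  (#|[set g in G | ea g \isn't a GRing.unit]| = #|J 1| * #|borel|)%N.
Proof.
have <- : (#|[set g in G | (ea g \is a GRing.unit) && (ec g \isn't a GRing.unit)]|
          = #|J 1| * #|borel|)%N.
  apply: card_lower_mul => [g|g y yE|g].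
  - by rewrite inE => /and3P[Gg ug _]; apply: lower_ratio.
  - rewrite !inE groupMl ?lowerG // (lower_clear yE) eqxx (unit_of_ratio yE).
    rewrite andbT andbC (pideal1_nunit hR) -iota_unit; congr (~~ _ && _).
    have := unitrM w (ec g); rewrite uw /= yE unitrM (unit_of_ratio yE) andbT.
    by move=> ->.
  - by rewrite inE => /andP[_ /eqP].
(* Left multiplication by the Weyl element exchanges [ea] and [ec]. When [ea] is a nonunit the
   determinant forces [ec] to be a unit, so the small cell goes onto the part of the big cell whose
   ratio lies in [J 1]. *)
rewrite -(card_imset _ (mulgI weyl)); apply: eq_card => g.
have WWg h : (weyl * (weyl * h))%g = h by rewrite mulgA weylK mul1g.
have Wa h : ea (weyl * h)%g = ec h by rewrite !mulGL2E !weylE; ring.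
have Wc h : ec (weyl * h)%g = ea h by rewrite !mulGL2E !weylE; ring.
apply/imsetP/idP => [[h]|]; rewrite !inE.
  move=> /andP[Gh nh] ->; rewrite groupM ?weylG //= Wa Wc nh andbT.
  have := edet_unit h.
  rewrite (_ : edet h = ec h * - eb h + ea h * ed h); last by rewrite /edet; ring.
  have [//|nc] := boolP (ec h \is a GRing.unit).
  have ch : ec h * - eb h \in I 1 by rewrite pidealMr ?(pideal1_nunit hS).
  by rewrite (unit_add_pideal hS _ ch) unitrM (negPf nh).
move=> /and3P[Gg ua nc]; exists (weyl * g)%g => //.
by rewrite inE groupM ?weylG //= Wa.
Qed.

Lemma card_rank_one : (#|G| = (#|R| + #|J 1|) * #|borel|)%N.
Proof.
rewrite mulnDl -card_bigcell -card_smallcell.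
rewrite -(cardsID [set g | ea g \is a GRing.unit] G).
by congr (_ + _)%N; apply: eq_card => g; rewrite !inE // andbC.
Qed.

(** The order of this subgroup is never computed: it divides out of the orders of [G] and of [polar]
    when the index is taken. *)
Definition borel1 : {set {'GL_2[S]}} := [set g in borel | ed g == ea g].

Let dratio g : R := odflt 0 [pick t | ed g == iota t * ea g].

Let dratioE g t : g \in borel -> ed g = iota t * ea g -> dratio g = t.
Proof.
move=> Bg tE; rewrite /dratio; case: pickP => [z /eqP|/(_ t)]; last by rewrite tE eqxx.
by rewrite tE => /(mulIr (proj1 (borel_unit Bg)))/iota_inj.
Qed.

(** The fibres of the ratio of diagonal entries are cosets of [borel1], translated by the torus
    elements of [rank_one_torus]. *)
Lemma card_torus_mul (A : {set {'GL_2[S]}}) (X : {set R}) :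
  A \subset borel -> {in X, forall t, t \is a GRing.unit} ->
  (forall g t, g \in borel -> ed g = iota t * ea g -> (g \in A) = (t \in X)) ->
  #|A| = (#|X| * #|borel1|)%N.
Proof.
move=> /subsetP sAB uX AX; apply: (@card_fibers _ _ _ _ dratio) => [g Ag|t Xt].
  have Bg := sAB g Ag; have := Bg; rewrite inE => /andP[Gg /eqP cg].
  have [t _ tE] := diag_ratio Gg cg; rewrite (dratioE Bg tE).
  by rewrite -(AX g t Bg tE).
have [u uu' Gd] := rank_one_torus hG (uX t Xt).
have ud : u * (iota t * u) - 0 * 0 \is a GRing.unit.
  by rewrite diag_unit // unitrM uu' iota_unit uX.
set d := gl2 _ _ _ _ in Gd.
have mulB b : b \in borel1 ->
    (d * b)%g \in borel /\ ed (d * b)%g = iota t * ea (d * b)%g.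
  rewrite !inE => /andP[/andP[Gb /eqP cb] /eqP dab].
  rewrite groupM //= !mulGL2E !(gl2E ud) cb dab; split; last by ring.
  by rewrite mulr0 mul0r addr0.
rewrite (_ : [set g in A | _] = [set (d * b)%g | b in borel1]).
  by rewrite card_imset //; apply: mulgI.
apply/setP => g; rewrite inE; apply/andP/imsetP => [[Ag /eqP gt]|[b Bb ->]].
  have Bg := sAB g Ag; have := Bg; rewrite inE => /andP[Gg /eqP cg].
  have [s us sE] := diag_ratio Gg cg; move: gt; rewrite (dratioE Bg sE) => st.
  rewrite st in sE; exists (d^-1 * g)%g; last by rewrite mulKVg.
  have dB : d \in borel by rewrite inE Gd (gl2E ud) eqxx.
  have dgB : (d^-1 * g)%g \in borel_group by rewrite groupM ?groupV.
  rewrite inE dgB /=; have := dgB; rewrite inE => /andP[_ /eqP c0].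
  have : ed (d * (d^-1 * g))%g = iota t * ea (d * (d^-1 * g))%g by rewrite mulKVg.
  rewrite eaM edM !(gl2E ud) c0 mulr0 mul0r addr0 add0r mulrA => /(mulrI _) -> //.
  by rewrite unitrM iota_unit uX.
by have [dbB dbE] := mulB b Bb; rewrite (AX _ t) // Xt (dratioE dbB dbE).
Qed.

Lemma card_borel : (#|borel| = #|[set t : R | t \is a GRing.unit]| * #|borel1|)%N.
Proof.
apply: card_torus_mul => // [t|g t Bg tE]; first by rewrite inE.
have [ua ud] := borel_unit Bg.
by rewrite Bg inE; move: ud; rewrite tE unitrM iota_unit => /andP[].
Qed.

(** * Degree [q] characters over a field *)

Section Field.
Hypotheses (l1 : l = 1%N) (hodd : odd (resq p)).
Variable psi : S -> algC.
Hypotheses (hpsi : additive_character psi) (psi1 : exists a, psi (iota a) != 1).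

Let unit_neq0 (x : R) : x != 0 -> x \is a GRing.unit.
Proof.
apply: contraR; rewrite -(pideal1_nunit hR) => x1.
by apply/eqP; apply: (pideal_eq0 hR _ x1); rewrite l1.
Qed.

Definition unipotent : {set {'GL_2[S]}} := upper @: setT.

Lemma unipotent_group_set : group_set unipotent.
Proof.
apply/group_setP; split=> [|_ _ /imsetP[x _ ->] /imsetP[y _ ->]].
  apply/imsetP; exists 0 => //.
  by apply: GL2_ext; rewrite !upperE !oneGL2E ?rmorph0 ?mul0r.
by rewrite -upperD; apply: imset_f.
Qed.
Canonical unipotent_group := Group unipotent_group_set.

Lemma upper_inj : injective upper.
Proof.
have uV : w^-1 \is a GRing.unit by rewrite unitrV.
by move=> x y /(congr1 (@eb S)); rewrite !upperE => /(mulIr uV)/iota_inj.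
Qed.

Let upper_conj (g : {'GL_2[S]}) t y : g \in borel -> ed g = iota t * ea g ->
  (upper y ^ g)%g = upper (y * t).
Proof.
move=> Bg tE; have [ua ud] := borel_unit Bg.
have := Bg; rewrite inE => /andP[_ /eqP c0].
apply: (mulgI g); rewrite -conjgC; apply: GL2_ext;
  by rewrite !mulGL2E !upperE ?c0 ?tE ?rmorphM /=; ring.
Qed.

Lemma unipotent_normal : (unipotent <| borel)%g.
Proof.
apply/normalP; split.
  by apply/subsetP => _ /imsetP[x _ ->]; rewrite inE upperG upperE eqxx.
move=> g Bg; apply/eqP; rewrite eqEcard cardJg leqnn andbT.
apply/subsetP => _ /imsetP[_ /imsetP[x _ ->] ->].
have := Bg; rewrite inE => /andP[Gg /eqP c0].
by have [t _ tE] := diag_ratio Gg c0; rewrite (upper_conj _ Bg tE) imset_f.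
Qed.

(** The kernel is normal, so with the upper unipotents it contains their Weyl conjugates, the lower
    ones. Together with the abelian torus [T] these generate [G], so the quotient of [G] by the
    kernel is abelian. *)
Let unipotent_ker_lin (i : Iirr G) :
  unipotent \subset cfker 'chi_i -> 'chi_i \is a linear_char.
Proof.
move=> /subsetP sUK; rewrite lin_irr_der1; apply: der1_min; first exact: cfker_norm.
have upK y : upper y \in cfker 'chi_i by apply: sUK; apply: imset_f.
have loK y : lower y \in cfker 'chi_i.
  rewrite (_ : lower y = upper y ^ weyl)%g.
    by rewrite memJ_norm // (subsetP (cfker_norm _)) ?weylG.
  by apply: (mulgI weyl); rewrite -conjgC; apply: GL2_ext; rewrite !mulGL2E !upperE !lowerE !weylE; ring.
pose T := [set g in G | (eb g == 0) && (ec g == 0)].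
have T_group : group_set T.
  apply/group_setP; split=> [|x y]; first by rewrite !inE group1 !oneGL2E eqxx.
  rewrite !inE => /and3P[Gx /eqP bx /eqP cx] /and3P[Gy /eqP b_y /eqP cy].
  by rewrite groupM //= !mulGL2E bx cx b_y cy !(mul0r, mulr0, addr0) eqxx.
have abT : abelian (Group T_group).
  apply/centsP => x; rewrite inE => /and3P[_ /eqP bx /eqP cx] y.
  rewrite inE => /and3P[_ /eqP b_y /eqP cy].
  by apply: GL2_ext; rewrite !mulGL2E ?(bx, cx, b_y, cy); ring.
(* On the big cell this is the factorisation into a lower unipotent, an upper unipotent and a
   diagonal matrix. *)
have cellP g : g \in G -> ea g \is a GRing.unit -> g \in (cfker 'chi_i * T)%g.
  move=> Gg ua; have [y yE] := lower_ratio Gg ua.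
  set b := (lower (- y) * g)%g.
  have Gb : b \in G by rewrite groupM ?lowerG.
  have cb : ec b = 0 by apply: lower_clear.
  have [uab udb] : ea b \is a GRing.unit /\ ed b \is a GRing.unit.
    by apply: borel_unit; rewrite inE Gb cb eqxx.
  have Gd := rank_one_diag hG Gb cb; set d := gl2 _ _ _ _ in Gd.
  have ud := diag_unit uab udb.
  have [||||z zE] := @upper_unipotent (b * d^-1)%g; first by rewrite groupM ?groupV.
  - apply: (mulIr uab); rewrite mul1r -[in RHS](mulgKV d b) [in RHS]eaM !(gl2E ud); ring.
  - apply: (mulIr uab); rewrite mul0r -[RHS]cb -[in RHS](mulgKV d b) [in RHS]ecM !(gl2E ud); ring.
  - apply: (mulIr udb); rewrite mul1r -[in RHS](mulgKV d b) [in RHS]edM !(gl2E ud); ring.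
  have -> : g = (lower y * upper z * d)%g.
    rewrite -zE -mulgA mulgKV /b mulgA -lowerD subrr.
    by rewrite -[LHS]mul1g; congr (_ * _)%g; apply: GL2_ext; rewrite !lowerE !oneGL2E ?rmorph0 ?mul0r.
  apply: mem_mulg; first by rewrite groupM ?loK ?upK.
  by rewrite inE Gd !(gl2E ud) !eqxx.
have GT : G \subset (cfker 'chi_i * T)%g.
  apply/subsetP => g Gg; have [/cellP->//|na] := boolP (ea g \is a GRing.unit).
  (* Off the big cell [ec g] is a unit, and multiplication by [upper 1] adds [ec g / w] to the
     nonunit [ea g]. *)
  have ug : ea (upper 1 * g)%g \is a GRing.unit.
    rewrite !mulGL2E !upperE rmorph1 mul1r mul1r.
    rewrite (unit_add_pideal hS) ?(pideal1_nunit hS) // unitrM unitrV uw /=.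
    have := edet_unit g.
    rewrite (_ : edet g = ea g * ed g + - eb g * ec g); last by rewrite /edet; ring.
    rewrite (unit_add_pideal hS) ?pidealMr ?(pideal1_nunit hS) // unitrM.
    by case/andP.
  have /cellP/(_ ug)/mulsgP[x y Kx Ty e] : (upper 1 * g)%g \in G by rewrite groupM ?upperG.
  apply/mulsgP; exists ((upper 1)^-1 * x)%g y => //; first by rewrite groupM ?groupV ?upK.
  by rewrite -mulgA -e mulKg.
apply: abelianS (quotient_abelian (cfker 'chi_i) abT).
apply: subset_trans (quotientS _ GT) _.
by rewrite quotientMidl.
Qed.

Lemma field_degree_q_mult_le1 (i j k : Iirr G) :
  'chi_i 1%g = (resq p)%:R -> 'chi_j 1%g = (resq p)%:R ->
  'chi_k 1%g = (resq p)%:R -> '['chi_i * 'chi_j, 'chi_k] <= 1.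
Proof.
have [psi0 psiD] := hpsi.
have oU : #|unipotent| = resq p.
  by rewrite card_imset; [rewrite cardsT (card_chain_ring hR) l1 expn1 | apply: upper_inj].
(* The factor [w] cancels the denominator in [upper y], so [xi] sends [upper y] to
   [psi (iota y)]. *)
have [||xi lxi xiE] := @linear_char_of_morphism _ unipotent_group (fun g => psi (w * eb g)).
- by rewrite oneGL2E mulr0.
- move=> _ _ /imsetP[x _ ->] /imsetP[y _ ->].
  by rewrite -psiD mulGL2E !upperE; congr psi; ring.
apply: (@steinberg_mult_le1 _ G borel_group unipotent_group (resq p) xi) => //.
- exact: borel_sub.
- exact: unipotent_normal.
- exact: odd_resq_gt2 hR hodd.
- apply/eqP; rewrite -(eqn_pmul2l (cardG_gt0 borel_group)) Lagrange ?borel_sub //.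
  rewrite card_rank_one (card_chain_ring hR) (card_pideal hR) l1 //.
  by rewrite subnn expn0 expn1 addn1 mulnC.
- move=> g h /setD1P[x1 /imsetP[x _ xE]] /setD1P[y1 /imsetP[y _ yE]].
  rewrite xE in x1 *; rewrite yE in y1 * => {g h xE yE}.
  have up0 : upper 0 = 1%g by apply: GL2_ext; rewrite !upperE !oneGL2E ?rmorph0 ?mul0r.
  have ux : x \is a GRing.unit by apply: unit_neq0; apply: contraNneq x1 => ->; rewrite up0.
  have uy : y \is a GRing.unit by apply: unit_neq0; apply: contraNneq y1 => ->; rewrite up0.
  (* A torus element with diagonal ratio [y / x] conjugates [upper x] to [upper y]. *)
  have ut : y / x \is a GRing.unit by rewrite unitrM unitrV uy.
  have [u uu' Gd] := rank_one_torus hG ut.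
  have ud : u * (iota (y / x) * u) - 0 * 0 \is a GRing.unit.
    by rewrite diag_unit // unitrM uu' iota_unit ut.
  have Bd : gl2 u 0 0 (iota (y / x) * u) \in borel by rewrite inE Gd (gl2E ud) eqxx.
  exists (gl2 u 0 0 (iota (y / x) * u)) => //.
  by rewrite (@upper_conj _ (y / x)) ?(gl2E ud) // mulrC divrK.
- apply/eqP => xi1; have [a /eqP[]] := psi1.
  have Ua : upper a \in unipotent by apply: imset_f.
  have := xiE _ Ua; rewrite xi1 cfun1E Ua !upperE mulrC divrK // => <- //.
Qed.

End Field.
End RankOne.

(** * The nilpotent representation of level [l >= 2] *)

Section Nilpotent.
Variables (R S : finComUnitRingType) (iota : {rmorphism R -> S}) (w : S).
Variables (G : {group {'GL_2[S]}}) (p : R) (l k m : nat).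
Hypotheses (hR : chain_ring p l) (hS : chain_ring (iota p) l).
Hypothesis hG : rank_one iota w G.
Hypotheses (m_gt0 : (0 < m)%N) (le_mk : (m <= k)%N) (le_k2m : (k <= m + m)%N)
  (kml : (k + m)%N = l).
Variable psi : S -> algC.
Hypotheses (hpsi : additive_character psi)
  (psi_prim : exists a, psi (iota (p ^+ l.-1 * a)) != 1).

Local Notation I := (pideal (iota p)).
Local Notation J := (pideal p).
Local Notation lower := (lower iota w).
Local Notation lowerE := (lowerE iota w).
Let uw : w \is a GRing.unit := rank_one_unit hG.

Let kk : (l <= k + k)%N. Proof. by rewrite -kml leq_add2l. Qed.

Let psiD x y : psi (x + y) = psi x * psi y. Proof. exact: (proj2 hpsi). Qed.
Let psi0 : psi 0 = 1. Proof. exact: (proj1 hpsi). Qed.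

Let psiB x y : psi x = psi y -> psi (x - y) = 1.
Proof. by move=> xy; rewrite psiD xy -psiD subrr. Qed.

Let psi_nondeg j x : (j <= l)%N ->
  (forall z, z \in J j -> psi (iota (x * z)) = 1) -> x \in J (l - j).
Proof. exact: (character_nondegenerate hR (f := fun x => psi (iota x))). Qed.

(** * The polarising subgroup and its linear characters *)

Definition polar : {set {'GL_2[S]}} :=
  [set g in G | (ec g \in I k) && (ea g - ed g \in I m)].

Lemma polar_group_set : group_set polar.
Proof.
apply/group_setP; split=> [|x y].
  by rewrite inE group1 !oneGL2E subrr !pideal_0.
rewrite !inE => /and3P[Gx cx adx] /and3P[Gy cy ady]; rewrite groupM //= !mulGL2E.
apply/andP; split; first by apply: pidealD; [apply: pidealMr|apply: pidealMl].
have -> : ea x * ea y + eb x * ec y - (ec x * eb y + ed x * ed y) =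
  ea x * (ea y - ed y) + (ea x - ed x) * ed y + eb x * ec y - ec x * eb y by ring.
have cx' := pideal_le le_mk cx; have cy' := pideal_le le_mk cy.
apply: pidealB; last exact: pidealMr.
by apply: pidealD; [apply: pidealD; [exact: pidealMl|exact: pidealMr]|exact: pidealMl].
Qed.
Canonical polar_group := Group polar_group_set.

Lemma polar_sub : polar \subset G.
Proof. by apply/subsetP => g; rewrite inE => /andP[]. Qed.

Lemma polar_unit g : g \in polar -> ea g \is a GRing.unit.
Proof.
rewrite inE => /and3P[_ cg _]; have := edet_unit g.
rewrite (_ : edet g = - eb g * ec g + ea g * ed g); last by rewrite /edet; ring.
have c1 : - eb g * ec g \in I 1.
  by apply: pidealMl; apply: pideal_le cg; apply: leq_trans le_mk.
by rewrite (unit_add_pideal hS _ c1) unitrM => /andP[].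
Qed.

Definition slope (g : {'GL_2[S]}) : S := w * ec g / ea g.

Let slopeE g v : ea g \is a GRing.unit -> w * ec g = v * ea g -> slope g = v.
Proof. by move=> ua e; rewrite /slope e mulrK. Qed.

(** The deviation from additivity is a combination of [ec g * ec h], [ec h * ec h] and
    [ec h * (ea g - ed g)]. These vanish because [2 k >= l] and [k + m = l], which is what the
    exponents in [polar] are made for. *)
Let slopeM : {in polar &, forall g h, slope (g * h)%g = slope g + slope h}.
Proof.
move=> g h Hg Hh; have ug := polar_unit Hg; have uh := polar_unit Hh.
apply: slopeE; first by apply: polar_unit; apply: (groupM (G := polar_group)).
move: Hg Hh; rewrite !inE => /and3P[_ cg adg] /and3P[_ ch adh].
apply: (mulrI ug); apply: (mulrI uh).
have -> : ea h * (ea g * ((slope g + slope h) * ea (g * h)%g))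
  = (w * ec g * ea h + w * ec h * ea g) * ea (g * h)%g.
  rewrite -(divrK ug (w * ec g)) -(divrK uh (w * ec h)) -/(slope g) -/(slope h).
  by ring.
have e1 : ec g * ec h = 0 by apply: (pideal_mul0 hS kk).
have e2 : ec h * ec h = 0 by apply: (pideal_mul0 hS kk).
have e3 : ec h * (ea g - ed g) = 0 by apply: (pideal_mul0 hS _ ch adg); rewrite kml.
apply/eqP; rewrite -subr_eq0 !mulGL2E; apply/eqP.
have -> : ea h * (ea g * (w * (ec g * ea h + ed g * ec h))) -
   (w * ec g * ea h + w * ec h * ea g) * (ea g * ea h + eb g * ec h) =
   - w * ea g * ea h * (ec h * (ea g - ed g)) - w * ea h * eb g * (ec g * ec h)
   - w * ea g * eb g * (ec h * ec h) by ring.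
by rewrite e1 e2 e3 !mulr0 !subr0.
Qed.

Definition slope_char t g := psi (iota t * slope g).

Let polar_lin_exists t : exists i : Iirr polar_group,
  [forall g in polar, 'chi_i g == slope_char t g].
Proof.
have [||xi lxi xiE] := @linear_char_of_morphism _ polar_group (slope_char t).
- by rewrite /slope_char /slope !oneGL2E mulr0 mul0r mulr0.
- by move=> g h Hg Hh; rewrite /slope_char slopeM // mulrDr psiD.
have /irrP[i iE] := lin_char_irr lxi.
by exists i; apply/forall_inP => g Hg; rewrite -iE xiE.
Qed.

(** Choosing an index makes it a function of [t], whose image can be counted later; by
    [polar_lin_exists] the default 0 is never reached. *)
Definition polar_lin t : Iirr polar_group :=
  odflt 0 [pick i | [forall g in polar, 'chi_i g == slope_char t g]].

Let polar_linE t g : g \in polar -> 'chi_(polar_lin t) g = slope_char t g.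
Proof.
move=> Hg; rewrite /polar_lin; case: pickP => [i /forall_inP/(_ g Hg)/eqP //|none].
by have [i] := polar_lin_exists t; rewrite none.
Qed.

Let polar_lin_linear t : 'chi_(polar_lin t) \is a linear_char.
Proof.
rewrite qualifE /= irr_char polar_linE ?(group1 polar_group) // /slope_char /slope.
by rewrite !oneGL2E mulr0 mul0r mulr0 psi0 eqxx.
Qed.

Let polar_lin_mul s t : 'chi_(polar_lin s) * 'chi_(polar_lin t) = 'chi_(polar_lin (s + t)).
Proof.
apply/cfun_inP => g Hg; rewrite cfunE !polar_linE // /slope_char -psiD.
by rewrite -mulrDl -rmorphD.
Qed.

Let lower_polar y : y \in J k -> lower y \in polar.
Proof.
move=> Jy; rewrite inE (lowerG hG) !lowerE subrr pideal_0 andbT pidealMr //.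
by rewrite (iota_pideal p hG).
Qed.

Let slope_lower y : slope (lower y) = iota y.
Proof. by apply: slopeE; rewrite !lowerE ?unitr1 // mulr1 mulrC divrK. Qed.

Let polar_lin_eq_mod s t : polar_lin s = polar_lin t -> s - t \in J m.
Proof.
move=> st; rewrite (_ : m = l - k)%N; last by rewrite -kml addKn.
apply: psi_nondeg => [|z Jz]; first by rewrite -kml leq_addr.
have := polar_linE s (lower_polar Jz); rewrite st polar_linE ?lower_polar // /slope_char slope_lower.
rewrite -!rmorphM => /esym/psiB.
by rewrite -rmorphB -mulrBl.
Qed.

(** Conjugation by a torus element of ratio [t^-1] fixes the diagonal entries and multiplies [ec] by
    [t]. The identity is stated for every [h], both sides being 0 off [polar], so that it can be
    substituted into the formula for an induced character. *)
Let torus_conj t : t \is a GRing.unit -> exists2 d, d \in G &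
  forall h, 'chi_(polar_lin t) h = 'chi_(polar_lin 1) (h ^ d)%g.
Proof.
move=> ut; have [|u uu Gd] := rank_one_torus hG (t := t^-1); first by rewrite unitrV.
set d := gl2 _ _ _ _ in Gd; exists d => // h.
have uit : iota t^-1 \is a GRing.unit by rewrite (iota_unit hR hS hG) unitrV.
have ud : u * (iota t^-1 * u) - 0 * 0 \is a GRing.unit.
  by rewrite diag_unit // unitrM uit.
have dh := conjgC h d; have Gh' := groupJr h Gd.
move: (h ^ d)%g dh Gh' => h' dh Gh'.
have ea' : ea h' = ea h.
  apply: (mulrI uu); have := congr1 (@ea S) dh.
  by rewrite !mulGL2E !(gl2E ud) mul0r mulr0 !addr0 => <-; rewrite mulrC.
have ed' : ed h' = ed h.
  have uiu : iota t^-1 * u \is a GRing.unit by rewrite unitrM uit.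
  apply: (mulrI uiu); have := congr1 (@ed S) dh.
  by rewrite !mulGL2E !(gl2E ud) mul0r mulr0 !add0r => <-; rewrite mulrC.
have ec' : ec h' = iota t * ec h.
  have := congr1 (@ec S) dh; rewrite !mulGL2E !(gl2E ud) mul0r mulr0 addr0 add0r.
  rewrite mulrAC => /(mulIr uu) e.
  by rewrite e mulrA -rmorphM mulrV // rmorph1 mul1r.
have Hh' : (h' \in polar) = (h \in polar).
  rewrite !inE ea' ed' ec' Gh' mulrC pidealMunit //.
  by rewrite (iota_unit hR hS hG).
have [Hh|nHh] := boolP (h \in polar); last by rewrite !cfun0 // Hh'.
rewrite !polar_linE ?Hh' // /slope_char /slope ea' ec' rmorph1 mul1r; congr psi; ring.
Qed.

Definition nilpotent_char : 'CF(G) := 'Ind[G] 'chi_(polar_lin 1).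

Let nilpotent_char_Ind t : t \is a GRing.unit -> 'Ind[G] 'chi_(polar_lin t) = nilpotent_char.
Proof.
move=> ut; have [d Gd dE] := torus_conj ut.
apply/cfun_inP => x Gx; rewrite !cfIndE ?polar_sub //; congr (_ * _).
under eq_bigr => y _ do rewrite dE -conjgM.
rewrite [RHS](reindex_inj (mulIg d)) /=.
by apply: eq_bigl => y; rewrite groupMr.
Qed.

(** Invariance is tested on [lower y] with [y] in [J k]: its slope is [y], that of its conjugate is
    [y * r], and nondegeneracy of [psi] gives the congruence. *)
Let lower_step g r : g \in G -> ea g * ea g = iota r * edet g ->
  {in polar, forall h, (h ^ g)%g \in polar ->
     'chi_(polar_lin 1) (h ^ g)%g = 'chi_(polar_lin 1) h} ->
  r - 1 \in J m.
Proof.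
move=> Gg rE inv; rewrite (_ : m = l - k)%N; last by rewrite -kml addKn.
apply: psi_nondeg => [|y Jy]; first by rewrite -kml leq_addr.
set h := lower y; have Hh : h \in polar by apply: lower_polar.
have uD := edet_unit g; set c0 := iota y / w.
have Ic0 : c0 \in I k by rewrite pidealMr ?(iota_pideal p hG).
have c0y : iota y * c0 = 0.
  by apply: (pideal_mul0 hS kk _ Ic0); rewrite (iota_pideal p hG).
have [aE _ cE dE] := conjGL2 g h.
have {aE}aE : edet g * ea (h ^ g)%g = edet g - c0 * ea g * eb g.
  by rewrite aE !mulGL2E !lowerE -/c0 /edet; ring.
have {dE}dE : edet g * ed (h ^ g)%g = edet g + c0 * ea g * eb g.
  by rewrite dE !mulGL2E !lowerE -/c0 /edet; ring.
have {cE}cE : ec (h ^ g)%g = c0 * iota r.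
  apply: (mulrI uD); rewrite cE !mulGL2E !lowerE -/c0.
  have -> : edet g * (c0 * iota r) = c0 * (iota r * edet g) by ring.
  by rewrite -rE; ring.
have Hhg : (h ^ g)%g \in polar.
  rewrite inE groupJ ?(lowerG hG) //= cE pidealMr //=.
  rewrite -(pidealMunit _ _ _ uD) mulrC mulrBr aE dE.
  rewrite (_ : _ - _ = c0 * (- 2%:R * ea g * eb g)); last by ring.
  by rewrite pidealMr // (pideal_le le_mk Ic0).
have crhg : slope (h ^ g)%g = iota y * iota r.
  apply: slopeE; first exact: polar_unit.
  apply: (mulrI uD); rewrite mulrCA [RHS]mulrCA aE cE mulrBr.
  have -> : iota y * iota r * (c0 * ea g * eb g) = iota y * c0 * (iota r * ea g * eb g) by ring.
  rewrite c0y mul0r subr0 -[in RHS](divrK uw (iota y)) -/c0; ring.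
have := inv h Hh Hhg; rewrite !polar_linE // /slope_char rmorph1 !mul1r crhg slope_lower.
by move/psiB; rewrite -rmorphM -rmorphB mulrBl mul1r mulrC.
Qed.

(** Invariance is tested on torus elements of ratio [1 + z] with [z] in [J j]: their slope is 0,
    that of the conjugate is [z * r]. The smallness condition keeps the conjugate in [polar] and
    removes the quadratic correction to its slope. *)
Let torus_step g r j : (m <= j)%N -> (j <= l)%N -> g \in G ->
  w * ea g * ec g = iota r * edet g ->
  (forall z, z \in J j -> z * r \in J k /\ iota (z * r) * (iota z * ec g) = 0) ->
  {in polar, forall h, (h ^ g)%g \in polar ->
     'chi_(polar_lin 1) (h ^ g)%g = 'chi_(polar_lin 1) h} ->
  r \in J (l - j).
Proof.
move=> mj jl Gg rE small inv; apply: psi_nondeg => // z Jz.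
have [zrk zr0] := small z Jz.
have Jz1 : z \in J 1 by apply: pideal_le Jz; apply: leq_trans mj.
have u1z : 1 + z \is a GRing.unit.
  by rewrite addrC (unit_add_pideal hR _ Jz1) unitr1.
have [u uu Gd] := rank_one_torus hG u1z.
set h := gl2 _ _ _ _ in Gd.
have ud : u * (iota (1 + z) * u) - 0 * 0 \is a GRing.unit.
  by rewrite diag_unit // unitrM uu (iota_unit hR hS hG) u1z.
have Iz : iota z \in I m by rewrite (iota_pideal p hG) (pideal_le mj Jz).
have zE : iota (1 + z) = 1 + iota z by rewrite rmorphD rmorph1.
have Hh : h \in polar.
  rewrite inE Gd !(gl2E ud) pideal_0 /= zE.
  by rewrite (_ : _ - _ = iota z * - u) ?pidealMr //; ring.
have crh : slope h = 0 by rewrite /slope !(gl2E ud) mulr0 mul0r.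
have uD := edet_unit g.
have [aE _ cE dE] := conjGL2 g h.
have {aE}aE : edet g * ea (h ^ g)%g = u * edet g - iota z * u * eb g * ec g.
  by rewrite aE !mulGL2E !(gl2E ud) zE /edet; ring.
have {dE}dE : edet g * ed (h ^ g)%g = u * edet g + iota z * u * ea g * ed g.
  by rewrite dE !mulGL2E !(gl2E ud) zE /edet; ring.
have {cE}cE : w * ec (h ^ g)%g = iota (z * r) * u.
  apply: (mulrI uD); rewrite mulrCA cE !mulGL2E !(gl2E ud) zE.
  rewrite rmorphM.
  have -> : edet g * (iota z * iota r * u) = iota z * u * (iota r * edet g) by ring.
  by rewrite -rE; ring.
have Hhg : (h ^ g)%g \in polar.
  rewrite inE groupJ //=; apply/andP; split.
    rewrite -(pidealMunit _ _ _ uw) mulrC cE pidealMr //.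
    by rewrite (iota_pideal p hG).
  rewrite -(pidealMunit _ _ _ uD) mulrC mulrBr aE dE.
  rewrite (_ : _ - _ = iota z * (- u * (eb g * ec g + ea g * ed g))); last by ring.
  by rewrite pidealMr.
have crhg : slope (h ^ g)%g = iota (z * r).
  apply: slopeE; first exact: polar_unit.
  apply: (mulrI uD); rewrite cE [RHS]mulrCA aE mulrBr.
  have -> : iota (z * r) * (iota z * u * eb g * ec g)
    = iota (z * r) * (iota z * ec g) * (u * eb g) by ring.
  by rewrite zr0 mul0r subr0; ring.
have := inv h Hh Hhg; rewrite !polar_linE // /slope_char rmorph1 !mul1r crhg crh psi0.
by rewrite mulrC.
Qed.

(** Mackey's criterion in contrapositive form: an element [g] that no [h] separates is shown to lie
    in [polar]. *)
Lemma nilpotent_irr : nilpotent_char \in irr G.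
Proof.
apply: Ind_lin_irr (polar_lin_linear 1) _; first exact: polar_sub.
move=> g Gg nHg.
have [/existsP[h /and3P[Hh Hhg ne]]|none] := boolP [exists h : {'GL_2[S]},
    [&& h \in polar, (h ^ g)%g \in polar & 'chi_(polar_lin 1) (h ^ g)%g != 'chi_(polar_lin 1) h]].
  by exists h.
case/negP: nHg.
have inv : {in polar, forall h, (h ^ g)%g \in polar ->
     'chi_(polar_lin 1) (h ^ g)%g = 'chi_(polar_lin 1) h}.
  move=> h Hh Hhg; apply/eqP; apply: contraT => ne.
  by case/negP: none; apply/existsP; exists h; rewrite Hh Hhg.
have [s sE] := rank_one_aa hG Gg; have [r rE] := rank_one_ac hG Gg.
have s1 := lower_step Gg sE inv.
have us : s \is a GRing.unit.
  rewrite -(subrK 1 s) (unit_add_pideal hR) ?unitr1 //.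
  exact: pideal_le s1.
have uD := edet_unit g.
have ua : ea g \is a GRing.unit.
  have : ea g * ea g \is a GRing.unit by rewrite sE unitrM (iota_unit hR hS hG) us.
  by rewrite unitrM => /andP[].
have ec_r j : (ec g \in I j) = (r \in J j).
  rewrite -(iota_pideal p hG) -(pidealMunit _ _ (iota r) uD) -rE mulrC pidealMunit //.
  by rewrite unitrM uw.
have kl : (k <= l)%N by rewrite -kml leq_addr.
have ml : (m <= l)%N by rewrite -kml leq_addl.
have lk : (l - k)%N = m by rewrite -kml addKn.
have lm : (l - m)%N = k by rewrite -kml addnK.
(* The torus test is run twice. With [j = k] the correction vanishes because [2 k >= l], which gives
   only [r] in [J m]. This bound and [k <= 2 m] then allow [j = m], which improves it to [J k]. *)
have rm : r \in J m.
  rewrite -lk; apply: (torus_step _ kl Gg rE _ inv) => // z Jz.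
  split; first exact: pidealMr.
  have zz : z * z = 0 by apply: (pideal_mul0 hR kk).
  have -> : iota (z * r) * (iota z * ec g) = iota (z * z) * (iota r * ec g).
    by rewrite !rmorphM; ring.
  by rewrite zz rmorph0 mul0r.
have rk : r \in J k.
  rewrite -lm; apply: (torus_step _ ml Gg rE _ inv) => // z Jz.
  have zr := pidealMul Jz rm.
  split; first exact: pideal_le zr.
  have Izr : iota (z * r) \in I k by rewrite (iota_pideal p hG) (pideal_le _ zr).
  apply: (pideal_mul0 hS _ Izr (j := m)); first by rewrite kml.
  by rewrite pidealMr ?(iota_pideal p hG).
rewrite inE Gg ec_r rk /= -(pidealMunit _ _ _ ua).
(* The congruence for [s] and the bound on [ec g] combine here into the condition on the diagonal
   entries. *)
have -> : (ea g - ed g) * ea g = iota (s - 1) * edet g - eb g * ec g.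
  by rewrite mulrBl sE rmorphB rmorph1 /edet; ring.
by apply: pidealB; [apply: pidealMr; rewrite (iota_pideal p hG)|apply: pidealMl; rewrite ec_r].
Qed.

(** * The degree of the nilpotent character *)

Let card_polar_borel :
  (#|polar :&: borel G| = #|J m| * #|borel1 G|)%N.
Proof.
rewrite (card_torus_mul hR hS hG (A := polar :&: borel G) (X := [set 1 + x | x in J m])).
- by rewrite (card_imset (mem (J m)) (addrI 1)).
- exact: subsetIr.
- move=> _ /imsetP[x Jx ->]; rewrite addrC (unit_add_pideal hR) ?unitr1 //.
  exact: pideal_le Jx.
move=> g t Bg tE; rewrite inE Bg andbT; have [ua _] := borel_unit Bg.
move: Bg; rewrite !inE => /andP[-> /eqP->]; rewrite pideal_0 /= tE.
rewrite -{1}(mul1r (ea g)) -mulrBl pidealMunit // -(rmorph1 iota) -rmorphB.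
rewrite (iota_pideal p hG) -pidealN opprB; apply/idP/imsetP => [Jt|[x Jx ->]].
  by exists (t - 1) => //; rewrite addrC subrK.
by rewrite addrC addKr.
Qed.

Let card_polar : (#|polar| = #|J k| * (#|J m| * #|borel1 G|))%N.
Proof.
rewrite -card_polar_borel; apply: (card_lower_mul hG) => [g Hg|g y yE|g].
- apply: (lower_ratio hR hS hG); last exact: polar_unit.
  by apply: (subsetP polar_sub).
- have ua := unit_of_ratio hG yE.
  have ck : (ec g \in I k) = (y \in J k).
    by rewrite -(iota_pideal p hG) -(pidealMunit _ _ (iota y) ua) -yE mulrC pidealMunit.
  have [Jy|nJy] := boolP (y \in J k); last first.
    by rewrite inE ck (negPf nJy) andbF.
  have Hl : lower (- y) \in polar_group by rewrite lower_polar ?pidealN.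
  rewrite in_setI (groupMl g Hl) /= [_ \in borel G]inE (lower_clear hG yE).
  rewrite eqxx andbT groupMl ?(lowerG hG) //=.
  by case Hg: (g \in polar) => //; rewrite (subsetP polar_sub).
- by rewrite !inE => /andP[_ /andP[_ /eqP]].
Qed.

(** Up to the common factor [#|borel1 G|], the order of [G] is [(q + 1) q^(l-1) (q - 1) q^(l-1)] and
    that of [polar] is [q^m q^k = q^l]. *)
Lemma index_polar : #|G : polar|%g = ((resq p ^ 2 - 1) * resq p ^ (l - 2))%N.
Proof.
have q_gt0 := resq_gt0 hR; set q := resq p in q_gt0 *.
apply/eqP; rewrite -(eqn_pmul2l (cardG_gt0 polar_group)) Lagrange ?polar_sub //.
rewrite /= card_polar (card_rank_one hR hS hG) (card_borel hR hS hG) (card_units hR).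
rewrite (card_chain_ring hR) !(card_pideal hR) -/q; try by rewrite -kml; lia.
have l2 : (1 < l)%N by rewrite -kml; lia.
have -> : (q ^ 2 - 1 = (q + 1) * (q - 1))%N.
  by rewrite -(exp1n 2) subn_sqr exp1n mulnC.
have -> : (l - k = m)%N by rewrite -kml addKn.
have -> : (l - m = k)%N by rewrite -kml addnK.
have -> : (q ^ l = q ^ 2 * q ^ (l - 2))%N by rewrite -expnD subnKC.
have e1 : (q ^ (l - 1) = q * q ^ (l - 2))%N by rewrite -expnS; congr (_ ^ _)%N; lia.
rewrite -subn1 e1.
have e2 : (q ^ m * q ^ k = q * (q * q ^ (l - 2)))%N.
  by rewrite -expnD -!expnS; congr (_ ^ _)%N; rewrite addnC kml; lia.
set n := #|borel1 G|; set Q := (q ^ (l - 2))%N in e2 *.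
rewrite (mulnA (q ^ m)%N) e2; apply/eqP; ring.
Qed.

Lemma nilpotent_degree : nilpotent_char 1%g = ((resq p ^ 2 - 1) * resq p ^ (l - 2))%:R.
Proof. by rewrite cfInd1 ?polar_sub // lin_char1 ?polar_lin_linear // mulr1 index_polar. Qed.

Lemma nilpotent_mult : odd (resq p) ->
  ((resq p - 2) * resq p ^ (m - 1))%:R <= '[nilpotent_char * nilpotent_char, nilpotent_char].
Proof.
move=> hodd.
have -> : '[nilpotent_char * nilpotent_char, nilpotent_char] = '['chi_(polar_lin 1) * 'Res[polar_group] nilpotent_char, 'Res[polar_group] nilpotent_char].
  by rewrite cfdot_Res_r -[in LHS]cfIndM ?polar_sub.
have ch_nilpotent : nilpotent_char \is a character by rewrite irrWchar ?nilpotent_irr.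
have chRes : 'Res[polar_group] nilpotent_char \is a character by rewrite cfRes_char.
pose T := [set t : R | (t \is a GRing.unit) && (1 + t \is a GRing.unit)].
pose X := (fun t => polar_lin (1 + t)) @: T.
have constt t : t \is a GRing.unit -> polar_lin t \in irr_constt ('Res[polar_group] nilpotent_char).
  move=> ut; rewrite irr_consttE cfdot_Res_l nilpotent_char_Ind // irrWnorm ?nilpotent_irr //.
  by rewrite oner_eq0.
apply: le_trans (cfdot_ge_common_constt (X := X) _ chRes _); first last.
- move=> i /imsetP[t]; rewrite inE => /andP[ut u1t] ->; split; last exact: constt.
  (* The character indexed by [1 + t] occurs in the product because [t] is a unit, and in the
     restriction itself because [1 + t] is one. *)
  have [psi' chpsi' RE] := constt_charP _ chRes (constt t ut).
  apply/constt_charP; first by rewrite rpredM ?irr_char.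
  exists ('chi_(polar_lin 1) * psi'); first by rewrite rpredM ?irr_char.
  by rewrite RE mulrDr polar_lin_mul.
- by rewrite rpredM ?irr_char.
rewrite ler_nat.
have cT : (#|T| = (resq p - 2) * resq p ^ (l - 1))%N.
  have l1 : (1 <= l)%N by case: hR.
  (* The complement of [T] is the disjoint union of the residue classes of 0 and of -1. *)
  have : (#|T| + (#|J 1| + #|J 1|) = #|R|)%N.
    rewrite -{2}(card_imset (mem (J 1)) (addrI (-1))).
    have := cardsUI (J 1) [set -1 + x | x in J 1].
    rewrite (_ : _ :&: _ = set0) ?cards0 ?addn0 => [<-|]; last first.
      apply/setP => x; rewrite !inE; apply/negP => /andP[Jx /imsetP[y Jy xE]].
      have : (1 : R) \in J 1 by rewrite -(addrK x 1) {1}xE addrA subrr add0r pidealB.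
      by rewrite (pideal1_nunit hR) unitr1.
    rewrite -(cardsC (J 1 :|: [set -1 + x | x in J 1])) addnC; congr (_ + _)%N.
    apply: eq_card => t; rewrite !inE negb_or (pideal1_nunit hR) negbK; congr (_ && _).
    rewrite -[LHS]negbK -(pideal1_nunit hR); congr (~~ _).
    apply/idP/imsetP => [Jt|[x Jx ->]]; last by rewrite addrA subrr add0r.
    by exists (1 + t) => //; rewrite addKr.
  rewrite (card_pideal hR) // (card_chain_ring hR) mulnBl -expnS subn1 prednK //.
  by rewrite addnn -mul2n => <-; rewrite addnK.
(* Parameters with the same character agree modulo [J m], an ideal of order [q^k]; this turns the
   exponent [l - 1] into [m - 1]. *)
have leT : (#|T| <= #|X| * #|J m|)%N.
  apply: leq_card_fibers => t0 _.
  rewrite -(card_imset (mem (J m)) (addrI t0)); apply/subset_leq_card/subsetP => t.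
  rewrite inE => /andP[_ /eqP/polar_lin_eq_mod e]; apply/imsetP; exists (t - t0).
    by move: e; rewrite opprD addrACA subrr add0r.
  by rewrite addrC subrK.
move: leT; rewrite cT (card_pideal hR) -?kml ?leq_addl // addnK.
have -> : (k + m - 1 = (m - 1) + k)%N by move: m_gt0; clear; lia.
rewrite expnD mulnA leq_pmul2r // expn_gt0.
by rewrite (resq_gt0 hR).
Qed.

(** * Restriction to the last congruence subgroup and regularity *)

Let K := Kcong G (iota p) l.

Let KE g : (g \in K) = [&& g \in G, ea g - 1 \in I l.-1, eb g \in I l.-1,
  ec g \in I l.-1 & ed g - 1 \in I l.-1].
Proof.
rewrite inE; case Gg: (g \in G) => //=; apply/existsP/and4P => [[M /eqP gE]|].
  rewrite /ea /eb /ec /ed gE !mxE /= !(mulr0n, mulr1n, add0r).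
  by rewrite !(addrC 1) !addrK; split; apply: mem_pideal.
case=> /pidealP[x xE] /pidealP[y yE] /pidealP[z zE] /pidealP[t tE].
exists (mx2 x y z t); apply/eqP; apply: mx2P;
  rewrite !mxE /= -?(xE, yE, zE, tE) ?mulr0n ?add0r // mulr1n.
- by rewrite addrC subrK.
- by rewrite addrC subrK.
Qed.

Let trE (g : {'GL_2[S]}) : \tr (GLval g - 1%:M) = ea g + ed g - 2%:R.
Proof.
rewrite /mxtrace big_ord_recl big_ord1 !mxE /= /ea /ed.
rewrite (_ : lift ord0 ord0 = 1); last exact/val_inj.
by rewrite !mulr1n; ring.
Qed.

Let tr_conj (g y : {'GL_2[S]}) :
  \tr (GLval (g ^ y)%g - 1%:M) = \tr (GLval g - 1%:M).
Proof.
rewrite !trE; congr (_ - _); apply: (mulrI (edet_unit y)).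
have [aE _ _ dE] := conjGL2 y g.
by rewrite mulrDr aE dE !mulGL2E /edet; ring.
Qed.

Let K_conj g y : y \in G -> ((g ^ y)%g \in K) = (g \in K).
Proof.
have K1 h z : z \in G -> h \in K -> (h ^ z)%g \in K.
  move=> Gz; rewrite !inE => /andP[Gh /existsP[M /eqP hE]]; rewrite groupJ // andTb.
  apply/existsP; exists (GLval z^-1 *m M *m GLval z).
  rewrite conjgE !GL_MxE hE mulmxA mulmxDr mulmxDl mulmx1.
  rewrite -scalemxAr -scalemxAl -GL_MxE mulVg.
  by rewrite GL_1E.
move=> Gy; apply/idP/idP => [|/K1->//].
by move/(K1 _ _ (groupVr Gy)); rewrite conjgK.
Qed.

Let K_lower y g : y \in J l.-1 -> ((lower y * g)%g \in K) = (g \in K).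
Proof.
have K1 x h : x \in J l.-1 -> h \in K -> (lower x * h)%g \in K.
  move=> Jx; rewrite !KE => /and5P[Gh ah bh ch dh].
  have Ix : iota x / w \in I l.-1 by rewrite pidealMr ?(iota_pideal p hG).
  rewrite groupM ?(lowerG hG) //= !mulGL2E !lowerE !mul0r !addr0 !mul1r ah bh /=.
  rewrite -addrA; apply/andP.
  by split; apply: pidealD => //; apply: pidealMr.
move=> Jy; apply/idP/idP => [|/K1->//].
have Jy' : - y \in J l.-1 by rewrite pidealN.
move/(K1 _ _ Jy'); rewrite mulgA -lowerD addNr.
rewrite (_ : lower 0 = 1%g) ?mul1g //.
by apply: GL2_ext; rewrite !lowerE !oneGL2E ?rmorph0 ?mul0r.
Qed.

Let l2 : (1 < l)%N.
Proof. by rewrite -kml; move: m_gt0 le_mk; clear; lia. Qed.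
Let kl1 : (k <= l.-1)%N.
Proof. by rewrite -kml; move: m_gt0; clear; lia. Qed.

Let K_polar g : g \in K -> g \in polar.
Proof.
rewrite KE inE => /and5P[-> ag _ cg dg]; rewrite (pideal_le kl1 cg) /=.
apply: (pideal_le (leq_trans le_mk kl1)).
have -> : ea g - ed g = ea g - 1 - (ed g - 1) by ring.
exact: pidealB.
Qed.

(** For [A] scalar modulo [pi], [psi_A] is invariant under conjugation by [G], so its product with
    the induced character reduces to one with [polar_lin 1] on [K]. The latter is nontrivial on
    lower unipotents of [K], where [psi_A] is trivial, so the product is 0. *)
Lemma nilpotent_regular (lie : pred 'M[S]_2) (i : Iirr G) : 'chi_i = nilpotent_char ->
  regular_ge2 lie (iota p) psi l i.
Proof.
move=> iE A _; rewrite /psiA_occurs iE -/K; apply: contraNN.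
move=> /existsP[c /existsP[B /eqP AE]].
(* The part of [A] divisible by [pi] is annihilated, since [g - 1] is a multiple of [pi ^+ l.-1]. *)
have trA g : g \in K -> \tr (A *m (GLval g - 1%:M)) = c * \tr (GLval g - 1%:M).
  rewrite inE => /andP[_ /existsP[M /eqP ->]]; rewrite addrC addKr.
  rewrite AE mulmxDl -scalemxAl -[B *m _]scalemxAr scalerA -exprS.
  rewrite (@prednK l) ?(ltnW l2) //.
  have [_ _ -> _] := hS; rewrite scale0r addr0.
  by rewrite mul_scalar_mx mxtraceZ.
rewrite (eq_bigr (fun g => #|polar|%:R^-1 * \sum_(y in G)
    'chi_(polar_lin 1) (g ^ y)%g * (psi (c * \tr (GLval g - 1%:M)))^*)); last first.
  by move=> g Kg; rewrite (trA g Kg) /nilpotent_char cfIndE ?polar_sub // -mulrA big_distrl.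
rewrite -big_distrr /= exchange_big /= big1 ?mulr0 // => y Gy.
set s := \sum_(_ in _) _; have [a a1] := psi_prim.
have Ja : p ^+ l.-1 * a \in J l.-1 by apply: mem_pideal.
set g0 := lower (p ^+ l.-1 * a).
have Hg0 : g0 \in polar by rewrite lower_polar // (pideal_le kl1 Ja).
have sE : s = \sum_(g in K) 'chi_(polar_lin 1) g * (psi (c * \tr (GLval g - 1%:M)))^*.
  rewrite /s (reindex_inj (conjg_inj y^-1%g)).
  apply: eq_big => g; first by rewrite K_conj ?groupV.
  by rewrite tr_conj conjgKV.
(* Translation by [g0] changes the trace only by a product of two multiples of [pi ^+ l.-1], which
   is 0 as [l >= 2]; the linear character gains the factor [psi (iota (p ^+ l.-1 * a))], which is
   not 1. *)
have : s = 'chi_(polar_lin 1) g0 * s.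
  rewrite {1}sE (reindex_inj (mulgI g0)) sE big_distrr.
  apply: eq_big => g; first by rewrite K_lower.
  rewrite K_lower // => Kg; rewrite (lin_charM (polar_lin_linear 1) Hg0 (K_polar Kg)) -mulrA.
  congr (_ * (_ * (psi (c * _))^*)); rewrite !trE !mulGL2E !lowerE.
  have eb0 : iota (p ^+ l.-1 * a) / w * eb g = 0.
    apply: (pideal_mul0 hS (i := l.-1) (j := l.-1)).
    - by move: l2; clear; lia.
    - by rewrite pidealMr ?(iota_pideal p hG).
    - by move: Kg; rewrite KE => /and5P[].
  by rewrite eb0; ring.
move/eqP; rewrite -subr_eq0 -{1}[s]mul1r -mulrBl mulf_eq0 => /orP[|/eqP//].
rewrite subr_eq0 polar_linE // /slope_char slope_lower rmorph1 mul1r eq_sym.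
by rewrite (negPf a1).
Qed.

Lemma nilpotent_sns (lie : pred 'M[S]_2) : odd (resq p) ->
  exists2 i : Iirr G, reg_sns lie (iota p) psi (resq p) l i &
    ((resq p - 2) * resq p ^ (m - 1))%:R <= '['chi_i * 'chi_i, 'chi_i].
Proof.
move=> hodd; have /irrP[i iE] := nilpotent_irr; exists i.
  rewrite /reg_sns (_ : l == 1%N = false); last by move: l2; case: l => [|[|]].
  by split; [exact: nilpotent_regular | rewrite -iE nilpotent_degree].
by rewrite -iE; apply: nilpotent_mult.
Qed.
End Nilpotent.

(** * Both levels for rank one groups, and the case of GL_2 *)

Lemma rank_one_thm_props (R S : finComUnitRingType) (iota : {rmorphism R -> S})
    (w : S) (G : {group {'GL_2[S]}}) (lie : pred 'M[S]_2) (p : R) (l : nat)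
    (psi : S -> algC) :
  chain_ring p l -> odd (resq p) -> chain_ring (iota p) l ->
  rank_one iota w G -> additive_character psi ->
  (exists a : R, psi (iota (p ^+ l.-1 * a)) != 1) ->
  thm_props G lie (iota p) psi (resq p) l.
Proof.
move=> hR hodd hS hG hpsi psi_prim; split=> [l1 i j k|l2].
  rewrite /reg_sns l1 /= => -[_ di] [_ dj] [_ dk].
  apply: (field_degree_q_mult_le1 hR hS hG l1 hodd hpsi) => //.
  by have [a] := psi_prim; rewrite l1 expr0 mul1r => a1; exists a.
(* The exponents are [k = uphalf l] and [m = l./2], and [k <= 2 m] holds because [m >= 1]. *)
have ukm : (uphalf l + l./2 = l)%N by rewrite uphalf_half -addnA addnn odd_double_half.
have le_mk : (l./2 <= uphalf l)%N by rewrite uphalf_half leq_addl.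
have m_gt0 : (0 < l./2)%N by rewrite half_gt0.
have le_k2m : (uphalf l <= l./2 + l./2)%N.
  by rewrite uphalf_half leq_add2r; apply: leq_trans m_gt0; case: odd.
have [i hi mi] := nilpotent_sns hR hS hG m_gt0 le_mk le_k2m ukm hpsi psi_prim lie hodd.
by exists i, i, i.
Qed.

Lemma rank_one_GL (R : finComUnitRingType) :
  rank_one (idfun : {rmorphism R -> R}) 1 (GLgroup_group 2 R).
Proof.
split=> //=.
- exact: unitr1.
- by move=> g _; exists (ea g * ec g / edet g); rewrite divrK ?edet_unit ?mul1r.
- by move=> g _; exists (ea g * ea g / edet g); rewrite divrK ?edet_unit.
- by move=> y; rewrite inE.
- by move=> t ut; exists 1; rewrite ?unitr1 ?inE.
- by rewrite inE.
- by move=> g _ _; rewrite inE.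
Qed.

(** * The unramified quadratic extension *)

Section Unramified.
Variables (R S : finComUnitRingType) (iota : {rmorphism R -> S}).
Variables (sigma : {rmorphism S -> S}) (theta : S) (eps : R) (p : R) (l : nat).
Hypotheses (hR : chain_ring p l) (hodd : odd (resq p)).
Hypothesis hS : unram_quad_ext iota sigma theta eps.

Let theta2 : theta * theta = iota eps.
Proof. by case: hS => _ <- _ _ _; rewrite expr2. Qed.
Let sigma_theta : sigma theta = - theta. Proof. by case: hS => _ _ [-> _]. Qed.
Let sigma_iota a : sigma (iota a) = iota a. Proof. by case: hS => _ _ [_ ->]. Qed.
Let decomp s : exists a b, s = iota a + iota b * theta.
Proof. by case: hS. Qed.
Let coord a b c d : iota a + iota b * theta = iota c + iota d * theta ->
  a = c /\ b = d.
Proof. by case: hS => _ _ _ _; apply. Qed.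

Let theta_unit : theta \is a GRing.unit.
Proof.
have [[ueps _] _ _ _ _] := hS; have := rmorph_unit iota ueps.
by rewrite -theta2 unitrM => /andP[].
Qed.

Let iota_injective : injective iota.
Proof.
by move=> a b ab; have [] // := @coord a 0 b 0; rewrite ab.
Qed.

Let sigmaK : involutive sigma.
Proof.
move=> s; have [a [b ->]] := decomp s.
by rewrite !(rmorphD, rmorphM, rmorphN, sigma_theta, sigma_iota) /= opprK.
Qed.

Lemma unram_fixed s : sigma s = s -> exists r, s = iota r.
Proof.
have [a [b ->]] := decomp s.
rewrite rmorphD rmorphM !sigma_iota sigma_theta mulrN -mulNr -rmorphN.
case/coord=> _ /eqP; rewrite -subr_eq0 -opprD oppr_eq0 -mulr2n -mulr_natl => /eqP e.
exists a; have -> : b = 0.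
  by apply: (mulrI (odd_resq_unit2 hR hodd)); rewrite e mulr0.
by rewrite rmorph0 mul0r addr0.
Qed.

(** A nonunit [a + b theta] has its norm [a^2 - eps b^2] in the maximal ideal of [R]. If [b] were a
    unit, [eps] would be a square modulo that ideal, hence a square by Hensel; so [b], and then [a],
    are divisible by [p]. *)
Lemma unram_chain_ring : chain_ring (iota p) l.
Proof.
have [l_gt0 _ pl pl1] := hR; split=> //; last 2 first.
- by rewrite -rmorphXn pl rmorph0.
- by rewrite -rmorphXn -(rmorph0 iota) (inj_eq iota_injective).
have [[ueps nsq] _ _ _ _] := hS.
move=> s; have [a [b ->]] := decomp s => nu.
have nN : a ^+ 2 - eps * b ^+ 2 \in pideal p 1.
  rewrite (pideal1_nunit hR); apply: contraNN nu => /(rmorph_unit iota).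
  have -> : iota (a ^+ 2 - eps * b ^+ 2) =
      (iota a + iota b * theta) * (iota a - iota b * theta).
    by rewrite !(rmorphB, rmorphM, rmorphXn) -theta2; ring.
  by rewrite unitrM => /andP[].
have Jb : b \in pideal p 1.
  rewrite (pideal1_nunit hR); apply/negP => ub.
  have [] := @square_of_square_mod _ _ _ hR (a / b) eps hodd ueps.
    rewrite -(pidealMunit _ _ _ (unitrX 2 ub)) -pidealN mulrBl exprMn exprVn.
    by rewrite divrK ?unitrX // opprB.
  by move=> z /eqP; rewrite (negPf (nsq z)).
have Ja : a \in pideal p 1.
  have : a ^+ 2 \in pideal p 1.
    rewrite -(subrK (eps * b ^+ 2) (a ^+ 2)); apply: pidealD => //.
    by apply: pidealMl; rewrite expr2; apply: pidealMl.
  rewrite (pideal1_nunit hR) unitrX_pos //.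
  by rewrite -(pideal1_nunit hR).
case/pidealP: Ja => x ->; case/pidealP: Jb => y ->.
by exists (iota x + iota y * theta); rewrite expr1 !rmorphM mulrDr mulrA.
Qed.

Let cS := unram_chain_ring.

Let unram_unit r : iota r \is a GRing.unit -> r \is a GRing.unit.
Proof.
apply: contraTT; rewrite -(pideal1_nunit hR) -(pideal1_nunit cS) => /pidealP[x ->].
by rewrite rmorphM rmorphXn mem_pideal.
Qed.

(** Every [t z = z + sigma y * sigma z] satisfies the equation. Since [t theta = theta * (2 - t 1)]
    and 2 is a unit, [t 1] or [t theta] is a unit. *)
Lemma unram_hilbert90 y : y * sigma y = 1 ->
  exists2 t, t \is a GRing.unit & sigma t = y * t.
Proof.
move=> Ny; have Ny' : sigma y * y = 1 by rewrite mulrC.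
pose t z := z + sigma y * sigma z.
have tE z : sigma (t z) = y * t z.
  by rewrite /t rmorphD rmorphM !sigmaK mulrDr mulrA Ny mul1r addrC.
have u2 : 2%:R \is a @GRing.unit S.
  by rewrite -(rmorph_nat iota 2); apply: rmorph_unit; apply: odd_resq_unit2 hR hodd.
have [u1|n1] := boolP (t 1 \is a GRing.unit); first by exists (t 1).
exists (t theta) => //.
have -> : t theta = theta * (- t 1 + 2%:R).
  by rewrite /t sigma_theta rmorph1; ring.
by rewrite unitrM theta_unit (unit_add_pideal cS) // pidealN (pideal1_nunit cS).
Qed.

(** Surjectivity by counting units in two ways. The norm gives [#|U| = #|N @: U| * #|K|]; the map
    [s] to [sigma s / s] is onto [K] by Hilbert 90, with cosets of [V] as fibres, and gives
    [#|U| = #|K| * #|V|]. *)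
Lemma unram_norm_surj t : t \is a GRing.unit ->
  exists2 u, u \is a GRing.unit & u * sigma u = iota t.
Proof.
pose U := [set s : S | s \is a GRing.unit].
pose V := [set iota t | t in [set t : R | t \is a GRing.unit]].
pose N (s : S) := s * sigma s.
pose K := [set s : S | N s == 1].
have NM x y : N (x * y) = N x * N y by rewrite /N rmorphM; ring.
have uN s : s \in U -> N s \is a GRing.unit.
  by rewrite inE => us; rewrite unitrM us rmorph_unit.
have KU s : s \in K -> s \in U.
  by rewrite !inE => /eqP Ns; have := unitr1 S; rewrite -Ns unitrM => /andP[].
have sNV : N @: U \subset V.
  apply/subsetP => _ /imsetP[s Us ->].
  have [|r rE] := @unram_fixed (N s); first by rewrite /N rmorphM sigmaK mulrC.
  rewrite rE; apply: imset_f; rewrite inE.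
  by apply: unram_unit; rewrite -rE uN.
have cU1 : (#|U| = #|N @: U| * #|K|)%N.
  apply: (@card_fibers _ _ _ _ N) => [s Us|_ /imsetP[s Us ->]]; first exact: imset_f.
  have us : s \is a GRing.unit by move: Us; rewrite inE.
  rewrite -(card_imset (mem K) (mulrI us)); apply: eq_card => x; rewrite inE.
  apply/andP/imsetP => [[Ux /eqP Nx]|[y Ky ->]].
    exists (s^-1 * x); last by rewrite mulVKr.
    rewrite inE; apply/eqP; apply: (mulrI (uN s Us)).
    by rewrite -NM mulVKr // mulr1.
  have := KU y Ky; move: Ky; rewrite !inE => /eqP Ny uy.
  by rewrite unitrM us uy NM Ny mulr1.
have cU2 : (#|U| = #|K| * #|V|)%N.
  apply: (@card_fibers _ _ _ _ (fun s => sigma s / s)) => [s|y].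
    rewrite !inE => us; have uss : sigma s \is a GRing.unit by rewrite rmorph_unit.
    by rewrite /N rmorphM sigmaK rmorphV // mulrA divrK // divrr.
  rewrite inE => /eqP Ny; have [s us sE] := unram_hilbert90 Ny.
  rewrite -(card_imset (mem V) (mulrI us)); apply: eq_card => x; rewrite inE.
  apply/andP/imsetP => [[Ux /eqP xE]|[_ /imsetP[r ur ->] ->]].
    have ux : x \is a GRing.unit by move: Ux; rewrite inE.
    have xE' : sigma x = y * x by rewrite -xE divrK.
    exists (s^-1 * x); last by rewrite mulVKr.
    have [|r rE] := @unram_fixed (s^-1 * x).
      have uss : sigma s \is a GRing.unit by rewrite rmorph_unit.
      apply: (mulrI uss); rewrite rmorphM rmorphV // mulVKr // xE' sE.
      by rewrite -mulrA mulVKr.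
    rewrite rE; apply: imset_f; rewrite inE; apply: unram_unit.
    by rewrite -rE unitrM unitrV us.
  rewrite inE in ur; have uir := rmorph_unit iota ur.
  have usr : s * iota r \is a GRing.unit by rewrite unitrM us.
  by rewrite inE usr rmorphM sigma_iota sE -(mulrA y) (mulrK usr).
have eNV : N @: U = V.
  apply/eqP; rewrite eqEcard sNV /=.
  have K0 : (0 < #|K|)%N.
    by apply/card_gt0P; exists 1; rewrite inE /N rmorph1 mulr1.
  by rewrite -(leq_pmul2r K0) -cU1 cU2 mulnC.
move=> ut; have : iota t \in N @: U by rewrite eNV imset_f ?inE.
by case/imsetP => u; rewrite inE => uu ->; exists u.
Qed.

Lemma GU2P (g : {'GL_2[S]}) :
  reflect [/\ sigma (ed g) * ea g + sigma (eb g) * ec g = 1,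
              sigma (ed g) * eb g + sigma (eb g) * ed g = 0,
              sigma (ec g) * ea g + sigma (ea g) * ec g = 0 &
              sigma (ec g) * eb g + sigma (ea g) * ed g = 1]
          (g \in GU_set sigma).
Proof.
have starE i j : mxstar sigma (GLval g) i j = sigma (GLval g (1 - j) (1 - i)).
  by case: (ord2P i) => ->; case: (ord2P j) => ->;
     rewrite ?subr0 ?subrr /mxstar !mulmx2E !mxE /=;
     rewrite !(mul0r, mul1r, mulr0, mulr1, add0r, addr0).
rewrite inE; apply: (iffP eqP) => [e|[e1 e2 e3 e4]].
  have entry i j : sigma (GLval g (1 - 0) (1 - i)) * GLval g 0 j +
      sigma (GLval g (1 - 1) (1 - i)) * GLval g 1 j = (1%:M : 'M[S]_2) i j.
    by rewrite -e mulmx2E !starE.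
  move: (entry 0 0) (entry 0 1) (entry 1 0) (entry 1 1).
  by rewrite !mxE /= !subr0 !subrr.
by apply: mx2P; rewrite mulmx2E !starE !mxE /= ?subr0 ?subrr.
Qed.

Lemma rank_one_GU : rank_one iota theta (GU_group sigma).
Proof.
(* This compares the adjugate formula for the inverse of [g] with its star. It turns [ea g * ea g]
   into [edet g] times a norm, and [theta * ea g * ec g] into [edet g] times an element fixed by
   [sigma]. *)
have adj g : g \in GU_group sigma -> ea g = edet g * sigma (ea g).
  case/GU2P => _ _ e3 e4; rewrite /edet.
  have -> : (ea g * ed g - eb g * ec g) * sigma (ea g) =
    ea g * (sigma (ea g) * ed g) - eb g * (sigma (ea g) * ec g) by ring.
  have -> : sigma (ea g) * ed g = 1 - sigma (ec g) * eb g by rewrite -e4; ring.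
  have -> : sigma (ea g) * ec g = - (sigma (ec g) * ea g).
    by apply/eqP; rewrite -addr_eq0 addrC e3.
  by ring.
split.
- exact: theta_unit.
- move=> x y [s]; have [a [b ->]] := decomp s => e; exists a.
  have [] // := @coord x 0 (y * a) (y * b).
  by rewrite e !rmorphM rmorph0; ring.
- move=> g Gg; have [|r rE] := @unram_fixed (theta * sigma (ea g) * ec g).
    have [_ _ e3 _] := GU2P _ Gg.
    have e3' : sigma (ea g) * ec g = - (sigma (ec g) * ea g).
      by apply/eqP; rewrite -addr_eq0 addrC e3.
    by rewrite !rmorphM sigmaK sigma_theta -[RHS]mulrA e3'; ring.
  by exists r; rewrite -rE {1}(adj g Gg); ring.
- move=> g Gg; have [|r rE] := @unram_fixed (ea g * sigma (ea g)).
    by rewrite rmorphM sigmaK mulrC.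
  by exists r; rewrite -rE {2}(adj g Gg); ring.
(* The lower left entry of a unipotent unitary matrix must be negated by [sigma]; dividing by
   [theta] achieves this. *)
- move=> y; have du : 1 * 1 - 0 * (iota y / theta) \is a GRing.unit.
    by rewrite mul0r subr0 mulr1 unitr1.
  apply/GU2P; rewrite !(gl2E du) !(rmorph0, rmorph1, rmorphM, rmorphV) //.
  rewrite sigma_theta sigma_iota invrN; split; ring.
(* A diagonal matrix with entries [u] and [t u] is unitary exactly when [t] times the norm of [u] is
   1. *)
- move=> t ut; have [|u uu uE] := @unram_norm_surj t^-1; first by rewrite unitrV.
  have uit := rmorph_unit iota ut.
  exists u => //; apply/GU2P.
  have du : u * (iota t * u) - 0 * 0 \is a GRing.unit by rewrite diag_unit ?unitrM ?uit.
  have tuu : iota t * (u * sigma u) = 1 by rewrite uE -rmorphM mulrV ?rmorph1.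
  rewrite !(gl2E du) !(rmorph0, rmorphM) sigma_iota -tuu; split; ring.
- have du : 0 * 0 - 1 * 1 \is a @GRing.unit S by rewrite mulr0 mulr1 sub0r unitrN1.
  by apply/GU2P; rewrite !(gl2E du) !(rmorph0, rmorph1); split; ring.
- move=> g Gg c0; have [e1 _ _ e4] := GU2P _ Gg.
  have [ua ud] : ea g \is a GRing.unit /\ ed g \is a GRing.unit.
    by apply: (@borel_unit _ (GU_group sigma)); rewrite inE Gg c0 eqxx.
  have du := diag_unit ua ud; apply/GU2P; rewrite !(gl2E du) rmorph0.
  move: e1 e4; rewrite c0 rmorph0 !mul0r !mulr0 !addr0 add0r => -> ->; split=> //; ring.
Qed.
End Unramified.

Theorem theorem1p3 (R : finComUnitRingType) (pi : R) (l : nat)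
  (hR : chain_ring pi l) (hodd : odd (resq pi)) :
  (* G = GL_2 *)
  (forall psi : R -> algC, additive_character psi ->
     (exists a : R, psi (pi ^+ l.-1 * a) != 1) ->
     thm_props (GLgroup_group 2 R) predT pi psi (resq pi) l) /\
  (* G = GU_2 *)
  (forall (S : finComUnitRingType) (iota : {rmorphism R -> S})
          (sigma : {rmorphism S -> S}) (theta : S) (eps : R),
     unram_quad_ext iota sigma theta eps ->
     forall psi : S -> algC, additive_character psi ->
     (exists a : R, psi (iota (pi ^+ l.-1 * a)) != 1) ->
     thm_props (GU_group sigma) (lieU sigma) (iota pi) psi (resq pi) l).
Proof.
split=> [psi hpsi psi_prim|S iota sigma theta eps hS psi hpsi psi_prim].
  exact: (rank_one_thm_props (iota := idfun) _ hR hodd hR (rank_one_GL R)).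
apply: (rank_one_thm_props _ hR hodd _ (rank_one_GU hR hodd hS)) => //.
exact: unram_chain_ring hS.
Qed.
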